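(* Let $k\ge1$, $0\le s<k$, $n=2^k$, and let $\Sigma$ be a maximal spread in $X_{k-s}$. Then $\mathcal{D}_\Sigma=\bigcup_{S\in\Sigma}\mathcal{D}_S$ is a $4$-design in $\mathcal{G}_{2^s,2^k}$.
   Context: Let $V=\mathbb{R}^n$, $n=2^k$, with orthonormal basis $(e_u)_{u\in\mathbb{F}_2^k}$; $X(a):e_u\mapsto e_{u+a}$, $Y(b):e_u\mapsto(-1)^{b\cdot u}e_u$, and $E=\langle -I,X(a),Y(b)\rangle$. The map $\pm X(a)Y(b)\mapsto(a,b)$ identifies $E/\{\pm I\}$ with $\mathbb{F}_2^{2k}$, with quadratic form $q(a,b)=a\cdot b$ of maximal Witt index. $X_w$ is the set of totally isotropic subspaces of dimension $w$ for $q$. For $S\in X_{k-s}$, the preimage $\tilde S\subset E$ is elementary abelian and $V$ splits into $2^{k-s}$ pairwise orthogonal common eigenspaces of $\tilde S$, each of dimension $2^s$; $\mathcal{D}_S$ is the set of these subspaces. A spread in $X_w$ is a set $\Sigma\subset X_w$ such that any two distinct elements intersect in $\{0\}$; it is maximal if $\bigcup_{S\in\Sigma}S$ equals the set of all isotropic vectors ($q(x)=0$) of $\mathbb{F}_2^{2k}$. Grassmannian designs: $\mathcal{G}_{m,n}$ is the Grassmannian with $O(\mathbb{R}^n)$-action, $L^2(\mathcal{G}_{m,n})=\bigoplus_\mu H^{2\mu}_{m,n}$ over partitions $\mu$ with at most $m$ parts, $H^{2\mu}_{m,n}$ the multiplicity-one component isomorphic to the irreducible $O(\mathbb{R}^n)$-representation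 associated with $2\mu$; a finite $\mathcal{D}$ is a $4$-design if $\sum_{x\in\mathcal{D}}f(x)=0$ for all $f\in H^{2\mu}_{m,n}$ with $1\le\sum_i\mu_i\le2$. *)

(* Defs.v *)
From HB Require Import structures.
From mathcomp Require Import all_boot all_order all_algebra all_fingroup.
From mathcomp Require Import all_classical all_reals all_analysis.

Set Implicit Arguments.
Unset Strict Implicit.
Unset Printing Implicit Defensive.

Import Order.TTheory GRing.Theory Num.Theory.
Import numFieldNormedType.Exports.

Local Open Scope classical_set_scope.
Local Open Scope ring_scope.

(* R^n is 'rV[R]_n with its standard inner product; matrices act on row vectors
   from the right. *)

Definition orthogonal_mx (R : realType) (n : nat) (g : 'M[R]_n) : Prop :=
  g *m g^T = 1%:M.

Definition move_vs (R : realType) (n : nat) (g : 'M[R]_n)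
    (U : {vspace 'rV[R]_n}) : {vspace 'rV[R]_n} :=
  (linfun (mulmxr g) @: U)%VS.

Definition grassmannian (R : realType) (m n : nat) : set {vspace 'rV[R]_n} :=
  [set U | \dim U = m].
Arguments grassmannian : clear implicits.

Definition row_span (R : realType) (m n : nat) (F : 'M[R]_(m, n)) :
    {vspace 'rV[R]_n} :=
  <<[seq row i F | i <- enum 'I_m]>>%VS.

(* The topology of the Grassmannian is the quotient topology of the set of
   orthonormal m-frames. *)
Definition grass_continuous (R : realType) (m n : nat)
    (f : {vspace 'rV[R]_n} -> R) : Prop :=
  {within [set F : 'M[R]_(m, n) | F *m F^T = 1%:M],
    continuous (fun F : 'M[R]_(m, n) => f (row_span F))}.

Definition tensor (R : realType) (n d : nat) : Type :=
  {ffun {ffun 'I_d -> 'I_n} -> R}.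
HB.instance Definition _ (R : realType) (n d : nat) :=
  GRing.Lmodule.on (tensor R n d).

Definition move_tensor (R : realType) (n d : nat) (g : 'M[R]_n)
    (w : tensor R n d) : tensor R n d :=
  [ffun j : {ffun 'I_d -> 'I_n} =>
    \sum_(i : {ffun 'I_d -> 'I_n}) w i * \prod_(t < d) g (i t) (j t)].

Definition permute_tensor (R : realType) (n d : nat) (p : 'S_d)
    (w : tensor R n d) : tensor R n d :=
  [ffun i : {ffun 'I_d -> 'I_n} => w [ffun t => i (p t)]].

Definition traceless (R : realType) (n d : nat) (w : tensor R n d) : Prop :=
  forall (t1 t2 : 'I_d) (i : {ffun 'I_d -> 'I_n}), t1 != t2 ->
    \sum_(x < n) w [ffun t => if (t == t1) || (t == t2) then x else i t] = 0.

Definition is_partition (lam : seq nat) : bool :=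
  sorted geq lam && (0%N \notin lam).

(* The boxes of the diagram of lam are numbered 0, ..., |lam| - 1 row by row;
   box t lies in row (reshape_index lam t) and column (reshape_offset lam t). *)
Definition row_stab (lam : seq nat) : {set 'S_(sumn lam)} :=
  [set p : 'S_(sumn lam) |
    [forall t, reshape_index lam (p t) == reshape_index lam t]]%SET.

Definition col_stab (lam : seq nat) : {set 'S_(sumn lam)} :=
  [set p : 'S_(sumn lam) |
    [forall t, reshape_offset lam (p t) == reshape_offset lam t]]%SET.

Definition young_symmetrizer (R : realType) (n : nat) (lam : seq nat)
    (w : tensor R n (sumn lam)) : tensor R n (sumn lam) :=
  \sum_(p in row_stab lam) \sum_(q in col_stab lam)
     (-1) ^+ q *: permute_tensor p (permute_tensor q w).

(* Weyl's construction of the irreducible representation of O(R^n) associated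
   with lam: the traceless tensors in the image of the Young symmetrizer. *)
Definition weyl_module (R : realType) (n : nat) (lam : seq nat) :
    set (tensor R n (sumn lam)) :=
  [set w | traceless w /\ exists t, w = young_symmetrizer t].

Definition intertwiner (R : realType) (m n : nat) (lam : seq nat)
    (phi : tensor R n (sumn lam) -> {vspace 'rV[R]_n} -> R) : Prop :=
  [/\ forall w, weyl_module w -> grass_continuous m (phi w),
      forall (c : R) w1 w2 U,
        weyl_module w1 -> weyl_module w2 -> grassmannian R m n U ->
        phi (c *: w1 + w2) U = c * phi w1 U + phi w2 U
    & forall g w U,
        orthogonal_mx g -> weyl_module w -> grassmannian R m n U ->
        phi (move_tensor g w) (move_vs g U) = phi w U].

(* The lam-isotypic component of the O(R^n)-module of functions on the
   Grassmannian, i.e. the union of the images of all intertwiners, which is a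
   subspace because the multiplicity is one.  Finite-dimensional O(R^n)-stable
   subspaces of L^2 consist of continuous functions.  Values of f outside the
   Grassmannian are irrelevant. *)
Definition isotypic (R : realType) (m n : nat) (lam : seq nat)
    (f : {vspace 'rV[R]_n} -> R) : Prop :=
  exists phi : tensor R n (sumn lam) -> {vspace 'rV[R]_n} -> R,
    intertwiner m phi /\
    exists2 w, weyl_module w & forall U, grassmannian R m n U -> f U = phi w U.

Definition grass_H (R : realType) (m n : nat) (mu : seq nat) :
    ({vspace 'rV[R]_n} -> R) -> Prop :=
  @isotypic R m n [seq i.*2 | i <- mu].

Definition is_4design (R : realType) (m n : nat) (D : set {vspace 'rV[R]_n}) :
    Prop :=
  [/\ D `<=` grassmannian R m n, finite_set D
    & forall mu : seq nat, is_partition mu -> (size mu <= m)%N ->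
        (1 <= sumn mu <= 2)%N ->
        forall f, grass_H m mu f -> \sum_(U \in D) f U = 0].

Lemma card_F2 (k : nat) : #|{: 'rV['F_2]_k}| = (2 ^ k)%N.
Proof. by rewrite card_mx card_Fp // mul1n. Qed.

(* The label in F_2^k of a coordinate of R^(2^k) : the basis vector e_u is the
   coordinate vector at the unique i with label i = u. *)
Definition label (k : nat) (i : 'I_(2 ^ k)) : 'rV['F_2]_k :=
  enum_val (cast_ord (esym (card_F2 k)) i).

Definition dot (k : nat) (a b : 'rV['F_2]_k) : 'F_2 := (a *m b^T) 0 0.

Definition opX (R : realType) (k : nat) (a : 'rV['F_2]_k) : 'M[R]_(2 ^ k) :=
  \matrix_(i, j) (label j == label i + a)%:R.

Definition opY (R : realType) (k : nat) (b : 'rV['F_2]_k) : 'M[R]_(2 ^ k) :=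
  \matrix_(i, j) ((-1) ^+ (dot b (label i) : nat) *+ (i == j)).

Inductive extraspecial (R : realType) (k : nat) : 'M[R]_(2 ^ k) -> Prop :=
| extraspecial1 : extraspecial 1%:M
| extraspecialN1 : extraspecial (- 1%:M)
| extraspecialX a : extraspecial (opX R a)
| extraspecialY b : extraspecial (opY R b)
| extraspecialM g h : extraspecial g -> extraspecial h -> extraspecial (g *m h)
| extraspecialV g : extraspecial g -> extraspecial (invmx g).

Notation F2pairs k := ('rV['F_2]_k * 'rV['F_2]_k)%type.

Definition qform (k : nat) (x : F2pairs k) : 'F_2 := dot x.1 x.2.

Definition isotropic_subspaces (k w : nat) : set {vspace F2pairs k} :=
  [set S | \dim S = w /\ forall x, x \in S -> qform x = 0].
Arguments isotropic_subspaces : clear implicits.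

(* The operator X(a)Y(b) first applies Y(b), hence the order of the factors in
   the row-vector convention. *)
Definition preimage_in_E (R : realType) (k : nat) (S : {vspace F2pairs k}) :
    set 'M[R]_(2 ^ k) :=
  [set g | extraspecial g /\
     exists2 x : F2pairs k, x \in S &
       exists e : bool, g = (-1) ^+ e *: (opY R x.2 *m opX R x.1)].
Arguments preimage_in_E R {k} S _.

Definition common_eigenspaces (R : realType) (n : nat) (G : set 'M[R]_n) :
    set {vspace 'rV[R]_n} :=
  [set U | U != 0%VS /\ exists chi : 'M[R]_n -> R,
     forall v, v \in U <-> forall g, G g -> v *m g = chi g *: v].

Definition D_ (R : realType) (k : nat) (S : {vspace F2pairs k}) :
    set {vspace 'rV[R]_(2 ^ k)} :=
  common_eigenspaces (preimage_in_E R S).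
Arguments D_ R {k} S _.

Definition spread (k w : nat) (Sigma : set {vspace F2pairs k}) : Prop :=
  Sigma `<=` isotropic_subspaces k w /\
  forall S T, Sigma S -> Sigma T -> S <> T -> (S :&: T = 0)%VS.

Definition maximal_spread (k w : nat) (Sigma : set {vspace F2pairs k}) : Prop :=
  spread w Sigma /\
  \bigcup_(S in Sigma) [set x | x \in S] = [set x : F2pairs k | qform x = 0].

(* Main.v *)
Require Import Defs.
From HB Require Import structures.
From mathcomp Require Import all_boot all_order all_algebra all_fingroup.
From mathcomp Require Import all_classical all_reals all_analysis.
From mathcomp Require Import ring lra.

Set Implicit Arguments.
Unset Strict Implicit.
Unset Printing Implicit Defensive.

Import Order.TTheory GRing.Theory Num.Theory.
Import numFieldNormedType.Exports.

Local Open Scope classical_set_scope.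
Local Open Scope ring_scope.

(* A component of type 2 mu with |mu| <= 2 is spanned by images of tensors of
   degree 2 or 4.  For such a component every intertwiner is a constant multiple
   of w |-> <w, P_U> or w |-> <w, P_U (x) P_U>, where P_U is the orthogonal
   projection onto U: evaluation at a fixed U is represented by a traceless tensor
   fixed by the stabilizer O(m) x O(n - m) of U, and sign changes, transpositions
   and one 3-4-5 reflection already force such a tensor to vanish when it is
   orthogonal to P_U (x) P_U.  The projections onto the eigenspaces of S are the
   signed averages of the Pauli operators X(a)Y(b) with (a, b) in S, hence
   orthogonality of characters turns the sum of P_U (x) P_U over D_S into
   2^-(k-s) times the sum of g (x) g over these operators.  A maximal spread covers
   each nonzero isotropic vector exactly once, and the sum of g (x) g over all
   isotropic vectors consists of contractions, which kill traceless tensors. *)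

(** * Orthonormal bases and projections *)

(** Why the isotropic sum consists of contractions: transposition multiplies X(a)Y(b) by (-1)^q(a,
    b), so the sum of g (x) g over all (a, b), averaged with its partial transpose, keeps exactly
    the isotropic vectors. The zero vector lies in every member of the spread and adds multiples of
    1 (x) 1; so all three pairings of the four slots occur, and tracelessness kills each of them.
    The same sign makes the operators of an isotropic S symmetric, so that their signed averages are
    orthogonal projections. Irreducibility and multiplicity one are replaced by a finite
    computation. Sign changes leave only components whose indices are paired; the symmetries of
    shape (4) or (2, 2) reduce these to one matrix M i j = u (i, i, j, j), and transpositions make M
    constant off its diagonal on the blocks cut out by m. The diagonal is the obstacle: signed
    permutations do not tie it to the other entries. For shape (4) the reflection does; for shape
    (2, 2) it vanishes by antisymmetry. *)

Lemma row_sqnorm_gt0 (R : realType) N (v : 'rV[R]_N) :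
  v != 0 -> 0 < (v *m v^T) 0 0.
Proof.
move=> v0; rewrite mxE lt_neqAle; apply/andP; split; last first.
  by apply: sumr_ge0 => i _; rewrite mxE -expr2 sqr_ge0.
apply: contra v0 => /eqP v0; apply/eqP/rowP => i; rewrite mxE.
have ge0 j : true -> 0 <= v 0 j * v^T j 0 by rewrite mxE -expr2 sqr_ge0.
have := psumr_eq0P ge0 (esym v0) (i := i) isT.
by rewrite mxE => H; apply/eqP; rewrite -sqrf_eq0 expr2 H.
Qed.

(** Gram-Schmidt for a subspace given as a predicate: a frame F in W that misses some w is extended
    by the normalized residual of w. Orthonormal rows number at most N, so the extension stops. *)
Lemma orthonormal_basis (R : realType) N (W : 'rV[R]_N -> Prop) :
  W 0 -> (forall c u v, W u -> W v -> W (c *: u + v)) ->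
  exists r (F : 'M[R]_(r, N)), [/\ F *m F^T = 1%:M, forall v, W (v *m F)
    & forall w, W w -> w *m F^T *m F = w].
Proof.
move=> W0 Wlin.
have Wsum (I : finType) (f : I -> 'rV[R]_N) (c : I -> R) :
    (forall i, W (f i)) -> W (\sum_i c i *: f i).
  by move=> Wf; elim/big_rec: _ => // i x _ Wx; exact: Wlin.
have step r (F : 'M[R]_(r, N)) : F *m F^T = 1%:M -> (forall v, W (v *m F)) ->
    (forall w, W w -> w *m F^T *m F = w) \/
    exists2 y, W y & col_mx y F *m (col_mx y F)^T = 1%:M.
  move=> FF WF.
  have [?|/existsNP[w /not_implyP[Ww Fw]]] :=
    pselect (forall w, W w -> w *m F^T *m F = w); first by left.
  right; pose z := w - w *m F^T *m F.
  have z0 : z != 0 by rewrite subr_eq0; apply/eqP => e; apply: Fw.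
  have Wz : W z by rewrite /z addrC -scaleN1r; apply: Wlin.
  have zF : z *m F^T = 0 by rewrite mulmxBl -!mulmxA FF mulmx1 subrr.
  pose c := (z *m z^T) 0 0.
  have c0 : 0 < c by exact: row_sqnorm_gt0.
  pose y := (Num.sqrt c)^-1 *: z.
  have yy : y *m y^T = 1%:M.
    rewrite /y linearZ /= -scalemxAl -scalemxAr scalerA -invfM -expr2.
    rewrite sqr_sqrtr 1?ltW //; apply/matrixP => i j; rewrite !ord1 !mxE /=.
    have -> : \sum_j z 0 j * z^T j 0 = c by rewrite /c mxE.
    by rewrite mulVf ?gt_eqF // eqxx.
  have yF : y *m F^T = 0 by rewrite -scalemxAl zF scaler0.
  have Fy : F *m y^T = 0 by rewrite -[LHS]trmxK trmx_mul trmxK yF trmx0.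
  exists y; first by rewrite /y -[_ *: z]addr0; apply: Wlin.
  by rewrite tr_col_mx mul_col_row yy FF yF Fy -scalar_mx_block.
suff grow d : forall r (F : 'M[R]_(r, N)), (N - r <= d)%N ->
    F *m F^T = 1%:M -> (forall i, W (row i F)) ->
    exists r (F : 'M[R]_(r, N)), [/\ F *m F^T = 1%:M, forall v, W (v *m F)
    & forall w, W w -> w *m F^T *m F = w].
  apply: (grow N 0%N 0); rewrite ?subn0 //; last by case.
  by apply/matrixP => -[].
elim: d => [|d IH] r F hd FF WF.
all: have WvF v : W (v *m F) by rewrite mulmx_sum_row; apply: Wsum.
all: have [?|[y Wy FF']] := step _ _ FF WvF; first by exists r, F.
all: have rN := mulmx1_min FF'.
  by move: hd rN; rewrite leqn0 subn_eq0 add1n ltnNge => ->.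
apply: (IH _ (col_mx y F)) => //; first by rewrite add1n subnS; case: (N - r)%N hd.
move=> i; rewrite -[i]splitK; case: (fintype.split i) => j /=.
  by rewrite rowKu row_id.
by rewrite rowKd.
Qed.

(** Orthonormal frames of the images of P and of 1 - P, stacked, form g. *)
Lemma projection_diagonalization (R : realType) n (P : 'M[R]_n)
    (U : {vspace 'rV[R]_n}) :
  P^T = P -> P *m P = P -> (forall v, v \in U <-> v *m P = v) ->
  \tr P = (\dim U)%:R /\
  exists2 g, orthogonal_mx g & P = g^T *m pid_mx (\dim U) *m g.
Proof.
move=> PT PP UP.
have frame (Q : 'M[R]_n) : Q^T = Q -> Q *m Q = Q ->
    exists r (F : 'M[R]_(r, n)), F *m F^T = 1%:M /\ F^T *m F = Q.
  move=> QT QQ.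
  have [||r [F [FF WF FW]]] := @orthonormal_basis R n (fun v => v *m Q = v).
  - by rewrite mul0mx.
  - by move=> c u v uQ vQ; rewrite mulmxDl -scalemxAl uQ vQ.
  have FQ : F *m Q = F by apply/row_matrixP => i; rewrite row_mul rowE WF.
  have QF : Q *m F^T *m F = Q.
    by apply/row_matrixP => i; rewrite !row_mul; apply: FW; rewrite -row_mul QQ.
  exists r, F; split=> //; have /(congr1 trmx) := QF.
  by rewrite !trmx_mul trmxK QT FQ.
have [r [F [FF FP]]] := frame _ PT PP.
have [||r' [F' [FF' FP']]] := frame (1%:M - P).
- by rewrite linearB /= trmx1 PT.
- by rewrite mulmxBl mul1mx mulmxBr mulmx1 PP subrr subr0.
have dU : \dim U = r.
  have hU : U = (linfun (mulmxr F) @: fullv)%VS.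
    apply/vspaceP => v; apply/idP/idP.
      move=> /UP vP; apply/memv_imgP; exists (v *m F^T); rewrite ?memvf //.
      by rewrite lfunE /= -mulmxA FP vP.
    move=> /memv_imgP[w _ ->]; apply/UP.
    by rewrite lfunE /= -FP mulmxA -[w *m F *m _]mulmxA FF mulmx1.
  rewrite hU limg_dim_eq ?dimvf /dim /= ?mul1n //.
  apply/eqP; rewrite -subv0; apply/subvP => v /memv_capP[_].
  rewrite memv_ker lfunE /= memv0 => /eqP vF.
  by rewrite -[v]mulmx1 -FF mulmxA vF mul0mx.
rewrite dU; split.
  by rewrite -FP mxtrace_mulC FF mxtrace1.
have F0 : F *m F'^T = 0.
  have FP1 : F *m P = F by rewrite -FP mulmxA FF mul1mx.
  have F'P : (1%:M - P) *m F'^T = F'^T by rewrite -FP' -mulmxA FF' mulmx1.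
  by rewrite -F'P mulmxA mulmxBr mulmx1 FP1 subrr mul0mx.
have F0' : F' *m F^T = 0 by rewrite -[LHS]trmxK trmx_mul trmxK F0 trmx0.
pose g := col_mx F F'.
have gg : g *m g^T = 1%:M.
  by rewrite tr_col_mx mul_col_row FF FF' F0 F0' -scalar_mx_block.
have gg' : g^T *m g = 1%:M by rewrite tr_col_mx mul_row_col FP FP' addrC subrK.
have en : (r + r' = n)%N.
  by apply/eqP; rewrite eqn_leq (mulmx1_min gg) (mulmx1_min gg').
(* The stacked matrix has r + r' rows; substituting r + r' for n makes it square. *)
clear -en FP F0 F0' FF FF'.
case: n / en P F F' FP F0 F0' FF FF' => P F F' FP F0 F0' FF FF'.
exists (col_mx F F').
  by rewrite /orthogonal_mx tr_col_mx mul_col_row FF FF' F0 F0' -scalar_mx_block.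
rewrite pid_mx_block tr_col_mx mul_row_block mul_row_col !mulmx0 !addr0.
by rewrite mulmx1 mul0mx addr0 FP.
Qed.

(** * Tensors and Weyl modules *)

Lemma tensor_linE (R : realType) n d (c : R) (w1 w2 : tensor R n d) i :
  (c *: w1 + w2) i = c * w1 i + w2 i.
Proof. by rewrite !ffunE. Qed.

Lemma tensor_sumE (R : realType) n d (I : finType) (A : pred I)
    (w : I -> tensor R n d) i :
  (\sum_(x | A x) w x) i = \sum_(x | A x) w x i.
Proof. exact: sum_ffunE. Qed.

Definition tdot (R : realType) n d (w u : tensor R n d) : R :=
  \sum_i w i * u i.

Lemma tdot_linl (R : realType) n d (c : R) (w1 w2 u : tensor R n d) :
  tdot (c *: w1 + w2) u = c * tdot w1 u + tdot w2 u.
Proof.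
rewrite mulr_sumr -big_split; apply: eq_bigr => i _ /=.
by rewrite tensor_linE mulrDl mulrA.
Qed.

Lemma tdotC (R : realType) n d (w u : tensor R n d) : tdot w u = tdot u w.
Proof. by apply: eq_bigr => i _; rewrite mulrC. Qed.

Lemma tdot_eq0 (R : realType) n d (w : tensor R n d) : tdot w w = 0 -> w = 0.
Proof.
move=> w0; apply/ffunP => i; rewrite [RHS]ffunE.
have ge0 j : true -> 0 <= w j * w j by rewrite -expr2 sqr_ge0.
have := psumr_eq0P ge0 w0 (i := i) isT.
by move=> H; apply/eqP; rewrite -sqrf_eq0 expr2 H.
Qed.

Lemma move_tensor_lin (R : realType) n d (g : 'M[R]_n) (c : R)
    (w1 w2 : tensor R n d) :
  move_tensor g (c *: w1 + w2) = c *: move_tensor g w1 + move_tensor g w2.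
Proof.
apply/ffunP => j; rewrite tensor_linE !ffunE mulr_sumr -big_split.
by apply: eq_bigr => i _ /=; rewrite tensor_linE mulrDl mulrA.
Qed.

Lemma move_tensorM (R : realType) n d (g h : 'M[R]_n) (w : tensor R n d) :
  move_tensor h (move_tensor g w) = move_tensor (g *m h) w.
Proof.
apply/ffunP => j; rewrite !ffunE.
under eq_bigr do rewrite ffunE mulr_suml.
rewrite exchange_big; apply: eq_bigr => i _ /=.
under eq_bigr do rewrite -mulrA -big_split.
rewrite -mulr_sumr; congr (_ * _).
under [RHS]eq_bigr do rewrite mxE.
by rewrite bigA_distr_bigA.
Qed.

Lemma move_tensor1 (R : realType) n d (w : tensor R n d) :
  move_tensor 1%:M w = w.
Proof.
apply/ffunP => j; rewrite !ffunE (bigD1 j) //= [X in _ + X]big1 ?addr0.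
  by rewrite big1 ?mulr1 // => t _; rewrite mxE eqxx.
move=> i /eqP ij; have [t tij] : exists t, i t != j t.
  apply: contrapT => /forallNP ij'; apply: ij; apply/ffunP => t.
  by apply/eqP; apply: contrapT => /negP; exact: ij'.
by rewrite (bigD1 t) //= mxE (negPf tij) mul0r mulr0.
Qed.

Lemma tdot_move (R : realType) n d (g : 'M[R]_n) (w u : tensor R n d) :
  tdot (move_tensor g w) u = tdot w (move_tensor g^T u).
Proof.
rewrite /tdot; under eq_bigr do rewrite ffunE mulr_suml.
rewrite exchange_big; apply: eq_bigr => i _ /=.
rewrite ffunE mulr_sumr; apply: eq_bigr => j _.
under [in RHS]eq_bigr do rewrite mxE.
by rewrite mulrAC mulrA.
Qed.

Lemma permute_tensor_lin (R : realType) n d (p : 'S_d) (c : R)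
    (w1 w2 : tensor R n d) :
  permute_tensor p (c *: w1 + w2) = c *: permute_tensor p w1 + permute_tensor p w2.
Proof. by apply/ffunP => j; rewrite tensor_linE !ffunE. Qed.

Lemma move_permute_tensor (R : realType) n d (g : 'M[R]_n) (p : 'S_d)
    (w : tensor R n d) :
  move_tensor g (permute_tensor p w) = permute_tensor p (move_tensor g w).
Proof.
apply/ffunP => j; rewrite !ffunE.
rewrite (reindex (fun i : {ffun 'I_d -> 'I_n} => [ffun t => i ((p^-1)%g t)])) /=.
  apply: eq_bigr => i _; rewrite ffunE; congr (w _ * _).
    by apply/ffunP => t; rewrite !ffunE permK.
  rewrite (reindex_perm p) /=; apply: eq_bigr => t _.
  by rewrite !ffunE permK.
exists (fun i : {ffun 'I_d -> 'I_n} => [ffun t => i (p t)]) => i _;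
  by apply/ffunP => t; rewrite !ffunE ?permK ?permKV.
Qed.

Lemma young_symmetrizer_lin (R : realType) n lam (c : R)
    (w1 w2 : tensor R n (sumn lam)) :
  young_symmetrizer (c *: w1 + w2) =
  c *: young_symmetrizer w1 + young_symmetrizer w2.
Proof.
rewrite /young_symmetrizer scaler_sumr -big_split; apply: eq_bigr => p _ /=.
rewrite scaler_sumr -big_split; apply: eq_bigr => q _ /=.
by rewrite !permute_tensor_lin scalerDr !scalerA mulrC.
Qed.

Lemma move_young_symmetrizer (R : realType) n lam (g : 'M[R]_n)
    (w : tensor R n (sumn lam)) :
  move_tensor g (young_symmetrizer w) = young_symmetrizer (move_tensor g w).
Proof.
have mv0 : move_tensor g 0 = 0 :> tensor R n (sumn lam).
  by apply/ffunP => j; rewrite !ffunE big1 // => i _; rewrite ffunE mul0r.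
have mvD u v : move_tensor g (u + v) =
    move_tensor g u + move_tensor g v :> tensor R n (sumn lam).
  by have := move_tensor_lin g 1 u v; rewrite !scale1r.
rewrite /young_symmetrizer (big_morph _ mvD mv0); apply: eq_bigr => p _.
rewrite (big_morph _ mvD mv0); apply: eq_bigr => q _.
have := move_tensor_lin g ((-1) ^+ q) (permute_tensor p (permute_tensor q w)) 0.
by rewrite mv0 !addr0 => ->; rewrite !move_permute_tensor.
Qed.

(** Contracting slots t1 and t2 turns the two factors of g there into an entry of g g^T, a Kronecker
    delta; what remains is a contraction of w, moved in the other slots. *)
Lemma traceless_move (R : realType) n d (g : 'M[R]_n) (w : tensor R n d) :
  orthogonal_mx g -> traceless w -> traceless (move_tensor g w).
Proof.
move=> gO tw t1 t2 j t12.
under eq_bigr do rewrite ffunE.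
rewrite exchange_big /=.
pose dset := fun t : 'I_d => (t == t1) || (t == t2).
pose pr (i : {ffun 'I_d -> 'I_n}) := \prod_(t | ~~ dset t) g (i t) (j t).
transitivity (\sum_(i : {ffun 'I_d -> 'I_n}) w i * (pr i * (i t1 == i t2)%:R)).
  apply: eq_bigr => i _; rewrite -mulr_sumr; congr (_ * _).
  have := congr1 (fun M : 'M[R]_n => M (i t1) (i t2)) gO; rewrite !mxE => <-.
  rewrite mulr_sumr; apply: eq_bigr => x _.
  rewrite (bigID dset) /= mulrC; congr (_ * _).
    by apply: eq_bigr => t nt; rewrite ffunE -/(dset t) (negPf nt).
  rewrite (bigD1 t1) /=; last by rewrite /dset eqxx.
  rewrite (bigD1 t2) /=; last by rewrite /dset eqxx orbT eq_sym.
  rewrite !ffunE !eqxx orbT big1 ?mulr1 ?mxE // => t.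
  by rewrite /dset; case: eqP => //=; case: eqP.
(* Group the index functions by their values off t1 and t2. *)
pose fl (i : {ffun 'I_d -> 'I_n}) : {ffun 'I_d -> 'I_n} :=
  [ffun t => if dset t then j t else i t].
rewrite (partition_big fl (fun i => fl i == i)) /=; last first.
  move=> i _; apply/eqP/ffunP => t; rewrite !ffunE; by case: (dset t).
apply: big1 => i /eqP ii.
transitivity (\sum_(x < n) w [ffun t => if dset t then x else i t] * pr i);
  last by rewrite -mulr_suml tw ?mul0r.
rewrite (bigID (fun l : {ffun 'I_d -> 'I_n} => l t1 == l t2)) /=.
rewrite [X in _ + X]big1 ?addr0; last first.
  by move=> l /andP[_ /negPf ->]; rewrite !mulr0.
rewrite (reindex_onto (fun x => [ffun t => if dset t then x else i t])
  (fun l : {ffun 'I_d -> 'I_n} => l t1)) /=; last first.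
  move=> l /andP[/eqP fli /eqP l12]; apply/ffunP => t; rewrite ffunE.
  rewrite -fli ffunE /dset; case: eqP => [->//|_] /=; case: eqP => // -> //.
apply: eq_big => x.
  rewrite !ffunE /dset !eqxx orbT eqxx andbT; apply/andP; split=> //.
  apply/eqP; rewrite -[RHS]ii; apply/ffunP => t; rewrite !ffunE.
  by rewrite -/(dset t); case: (dset t).
move=> _; rewrite !ffunE /dset !eqxx orbT eqxx mulr1; congr (_ * _).
by apply: eq_bigr => t nt; rewrite ffunE -/(dset t) (negPf nt).
Qed.

Lemma weyl_module0 (R : realType) n lam : @weyl_module R n lam 0.
Proof.
split; first by move=> t1 t2 i _; rewrite big1 // => x _; rewrite ffunE.
exists 0; have := young_symmetrizer_lin (-1) (0 : tensor R n (sumn lam)) 0.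
by rewrite !scaleN1r oppr0 addr0 addNr.
Qed.

Lemma weyl_module_lin (R : realType) n lam c (w1 w2 : tensor R n (sumn lam)) :
  weyl_module w1 -> weyl_module w2 -> weyl_module (c *: w1 + w2).
Proof.
move=> [tw1 [u1 wu1]] [tw2 [u2 wu2]]; split.
  move=> t1 t2 i t12; under eq_bigr do rewrite tensor_linE.
  by rewrite big_split /= -mulr_sumr tw1 // tw2 // mulr0 addr0.
by exists (c *: u1 + u2); rewrite young_symmetrizer_lin wu1 wu2.
Qed.

Lemma weyl_module_move (R : realType) n lam g (w : tensor R n (sumn lam)) :
  orthogonal_mx g -> weyl_module w -> weyl_module (move_tensor g w).
Proof.
move=> gO [tw [u wu]]; split; first exact: traceless_move.
by exists (move_tensor g u); rewrite wu move_young_symmetrizer.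
Qed.

(** The functional is only assumed linear on W, as an intertwiner is only linear on the Weyl module.
    The representing vector is the sum of l(f) f over an orthonormal basis of W. *)
Lemma tensor_riesz (R : realType) n d (W : tensor R n d -> Prop)
    (l : tensor R n d -> R) :
  W 0 -> (forall c u v, W u -> W v -> W (c *: u + v)) ->
  (forall c u v, W u -> W v -> l (c *: u + v) = c * l u + l v) ->
  exists2 u, W u & forall w, W w -> l w = tdot w u.
Proof.
move=> W0 Wlin llin.
pose I := {ffun 'I_d -> 'I_n}.
pose tr (w : tensor R n d) : 'rV[R]_#|I| := \row_i w (enum_val i).
pose rt (v : 'rV[R]_#|I|) : tensor R n d := [ffun i => v 0 (enum_rank i)].
have trK w : rt (tr w) = w by apply/ffunP => i; rewrite ffunE mxE enum_rankK.
have rtlin c u v : rt (c *: u + v) = c *: rt u + rt v.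
  by apply/ffunP => i; rewrite tensor_linE !ffunE !mxE.
have rt0 : rt 0 = 0 by apply/ffunP => i; rewrite !ffunE mxE.
have [||r [F [FF WF FW]]] := @orthonormal_basis R _ (fun v => W (rt v)).
- by rewrite rt0.
- by move=> c u v Wu Wv; rewrite rtlin; apply: Wlin.
have l0 : l 0 = 0.
  by have := llin (-1) 0 0 W0 W0; rewrite scaler0 addr0 => ->; ring.
have lsum (v : 'rV[R]_r) : l (rt (v *m F)) = \sum_i v 0 i * l (rt (row i F)).
  have WF' i : W (rt (row i F)) by rewrite rowE; apply: WF.
  rewrite mulmx_sum_row.
  suff [] : W (rt (\sum_i v 0 i *: row i F)) /\
     l (rt (\sum_i v 0 i *: row i F)) = \sum_i v 0 i * l (rt (row i F)) by [].
  elim/big_rec2: _ => [|i y x _ [Wx <-]]; first by rewrite rt0.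
  by rewrite rtlin; split; [apply: Wlin | rewrite llin].
exists (rt ((\row_i l (rt (row i F))) *m F)); first exact: WF.
move=> w Ww; rewrite -[in LHS](trK w) -[tr w]FW ?trK // lsum.
rewrite /tdot (reindex_onto (@enum_val I predT) (@enum_rank I)) /=; last first.
  by move=> i _; rewrite enum_rankK.
under [RHS]eq_bigl do rewrite enum_valK eqxx.
under [RHS]eq_bigr do rewrite ffunE enum_valK mxE mulr_sumr.
rewrite exchange_big; apply: eq_bigr => j _ /=.
rewrite [X in X * _]mxE mulr_suml; apply: eq_bigr => i _.
by rewrite !mxE; ring.
Qed.

(* Multiplicity one: the functionals [phi _ U0] and [w |-> tdot w (Pi P0)] are
   both represented by vectors of the Weyl module fixed by the stabilizer of
   [U0], and such fixed vectors are assumed to form at most a line. *)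
Lemma intertwiner_scalar (R : realType) m n lam
    (Pi : 'M[R]_n -> tensor R n (sumn lam))
    (phi : tensor R n (sumn lam) -> {vspace 'rV[R]_n} -> R) :
  (m <= n)%N ->
  (forall g P, move_tensor g (Pi P) = Pi (g^T *m P *m g)) ->
  (forall u, weyl_module u ->
     (forall h, orthogonal_mx h -> h *m pid_mx m = pid_mx m *m h ->
        move_tensor h u = u) ->
     tdot u (Pi (pid_mx m)) = 0 -> u = 0) ->
  intertwiner m phi ->
  exists c, forall w (U : {vspace 'rV[R]_n}) P, weyl_module w -> P^T = P -> P *m P = P ->
    (forall v, v \in U <-> v *m P = v) -> \dim U = m ->
    phi w U = c * tdot w (Pi P).
Proof.
move=> mn Pimove uniq [_ phiL phiI].
pose P0 : 'M[R]_n := pid_mx m.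
have P0T : P0^T = P0 by rewrite /P0 tr_pid_mx.
have P0P : P0 *m P0 = P0 by rewrite /P0 pid_mx_id.
pose U0 : {vspace 'rV[R]_n} := limg (linfun (mulmxr P0)).
have U0P v : v \in U0 <-> v *m P0 = v.
  split=> [/memv_imgP[w _ ->]|e]; first by rewrite lfunE /= -mulmxA P0P.
  by apply/memv_imgP; exists v; rewrite ?memvf // lfunE.
have dU0 : \dim U0 = m.
  have [trP0 _] := projection_diagonalization P0T P0P U0P.
  apply/eqP; rewrite -(eqr_nat R) -trP0 /mxtrace; apply/eqP.
  under eq_bigr do rewrite mxE eqxx /=.
  rewrite -(big_mkord xpredT (fun i => (i < m)%:R)) (@big_cat_nat _ _ _ m) //=.
  rewrite [X in X + _](eq_big_nat _ _ (F2 := fun=> 1)); last first.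
    by move=> i /andP[_ ->].
  rewrite [X in _ + X]big_nat [X in _ + X]big1 ?addr0; last first.
    by move=> i /andP[mi _]; rewrite ltnNge mi.
  by rewrite sumr_const_nat subn0.
have U0m : grassmannian R m n U0 by [].
have moveU0 h : orthogonal_mx h -> h *m P0 = P0 *m h -> move_vs h U0 = U0.
  move=> hO hP; apply/vspaceP => v; apply/idP/idP.
    move=> /memv_imgP[w /U0P wP ->]; apply/U0P.
    by rewrite lfunE /= -mulmxA hP mulmxA wP.
  move=> /U0P vP; apply/memv_imgP; exists (v *m h^T).
    apply/U0P; rewrite -mulmxA -{1}P0T -trmx_mul -hP trmx_mul P0T.
    by rewrite mulmxA vP.
  by rewrite lfunE /= -mulmxA (mulmx1C hO) mulmx1.
have [|||u Wu uP] := @tensor_riesz R n _ (@weyl_module R n lam) (phi^~ U0).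
- exact: weyl_module0.
- exact: weyl_module_lin.
- by move=> c w1 w2 W1 W2; apply: phiL.
have [|||p Wp pP] := @tensor_riesz R n _ (@weyl_module R n lam)
  (fun w => tdot w (Pi P0)).
- exact: weyl_module0.
- exact: weyl_module_lin.
- by move=> c w1 w2 _ _; apply: tdot_linl.
have trO (h : 'M[R]_n) : orthogonal_mx h -> orthogonal_mx h^T.
  by move=> hO; rewrite /orthogonal_mx trmxK; apply: mulmx1C.
have trP h : orthogonal_mx h -> h *m P0 = P0 *m h -> h^T *m P0 = P0 *m h^T.
  by move=> _ /(congr1 trmx); rewrite !trmx_mul P0T.
(* The difference d = h v - v lies in the Weyl module, and invariance under h^T, taken at w = d,
   gives <d, d> = 0. *)
have inv (v : tensor R n (sumn lam)) : weyl_module v ->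
    (forall h w, orthogonal_mx h -> h *m P0 = P0 *m h -> weyl_module w ->
       tdot (move_tensor h w) v = tdot w v) ->
    forall h, orthogonal_mx h -> h *m P0 = P0 *m h -> move_tensor h v = v.
  move=> Wv vI h hO hP; apply/eqP; rewrite -subr_eq0; apply/eqP.
  have Wd : weyl_module (move_tensor h v - v).
    rewrite addrC -scaleN1r; apply: weyl_module_lin => //.
    exact: weyl_module_move.
  apply: tdot_eq0; set x := _ - v.
  have xE : x = (-1) *: v + move_tensor h v by rewrite scaleN1r addrC.
  rewrite {1}xE tdot_linl tdot_move ![tdot v _]tdotC.
  by rewrite vI ?mulN1r ?addNr //; [apply: trO | apply: trP].
have uI := inv u Wu.
have pI := inv p Wp.
have {}uI : forall h, orthogonal_mx h -> h *m P0 = P0 *m h ->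
    move_tensor h u = u.
  apply: uI => h w hO hP Ww; rewrite -!uP //; last exact: weyl_module_move.
  by rewrite -[in LHS](moveU0 h) // phiI.
have {}pI : forall h, orthogonal_mx h -> h *m P0 = P0 *m h ->
    move_tensor h p = p.
  apply: pI => h w hO hP Ww; rewrite -!pP //; last exact: weyl_module_move.
  rewrite tdot_move Pimove trmxK; congr (tdot w (Pi _)).
  by rewrite hP -mulmxA hO mulmx1.
(* If p = 0, the pairing with [Pi P0] vanishes on the Weyl module and [uniq] gives u = 0. Otherwise
   [uniq] applies to the component of u orthogonal to p. *)
have [c uc] : exists c, u = c *: p.
  have [p0|/eqP p0] := eqVneq (tdot p p) 0.
    exists 0; rewrite scale0r; apply: uniq => //.
    by rewrite pP // (tdot_eq0 p0); apply: big1 => i _; rewrite ffunE mulr0.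
  exists (tdot u p / tdot p p); apply/eqP; rewrite -subr_eq0; apply/eqP.
  set c := _ / _; rewrite addrC -scaleNr; apply: uniq.
  - exact: weyl_module_lin.
  - by move=> h hO hP; rewrite move_tensor_lin uI ?pI.
  - rewrite pP; last exact: weyl_module_lin.
    by rewrite tdot_linl /c mulNr divfK ?addNr //; apply/eqP.
exists c => w U P Ww PT PP UP dU.
(* Every U is the image of the coordinate subspace [U0] under the g that diagonalizes its
   projection, so invariance transports the identity from [U0] to U. *)
have [_ [g gO]] := projection_diagonalization PT PP UP.
rewrite dU -/P0 => Pg.
have gO' := trO _ gO.
have UU : U = move_vs g U0.
  apply/vspaceP => v; apply/idP/idP.
    move=> /UP vP; apply/memv_imgP; exists (v *m g^T).
      apply/U0P; rewrite -[in RHS]vP Pg -!mulmxA gO mulmx1.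
      by rewrite !mulmxA.
    by rewrite lfunE /= -mulmxA (mulmx1C gO) mulmx1.
  move=> /memv_imgP[x /U0P xP ->]; apply/UP; rewrite lfunE /= Pg.
  by rewrite !mulmxA -[x *m g *m _]mulmxA gO mulmx1 xP.
have wE : w = move_tensor g (move_tensor g^T w).
  by rewrite move_tensorM (mulmx1C gO) move_tensor1.
have Ww' : weyl_module (move_tensor g^T w) by exact: weyl_module_move.
rewrite {1}wE UU phiI // uP // uc.
have cE (x y : tensor R n (sumn lam)) : tdot x (c *: y) = c * tdot x y.
  rewrite /tdot mulr_sumr; apply: eq_bigr => i _.
  by rewrite ffunE; exact: mulrCA.
rewrite cE -pP // tdot_move trmxK Pimove.
by rewrite -Pg.
Qed.

(** * Tensors fixed by the stabilizer of a coordinate subspace *)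

(** For a signed permutation matrix the sum in [move_tensor] has a single nonzero term. *)
Lemma monomial_move (R : realType) n d (s : 'I_n -> R) (pi : 'S_n)
    (u : tensor R n d) j :
  move_tensor (\matrix_(a, b) (s b * (a == pi b)%:R)) u j =
  u [ffun t => pi (j t)] * \prod_(t < d) s (j t).
Proof.
rewrite ffunE (bigD1 [ffun t => pi (j t)]) //= [X in _ + X]big1 ?addr0.
  by congr (_ * _); apply: eq_bigr => t _; rewrite mxE ffunE eqxx mulr1.
move=> i /eqP ij; have [t tij] : exists t, i t != pi (j t).
  apply: contrapT => /forallNP ij'; apply: ij; apply/ffunP => t.
  by rewrite ffunE; apply/eqP; apply: contrapT => /negP; exact: ij'.
by rewrite (bigD1 t) //= mxE (negPf tij) !mulr0 mul0r mulr0.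
Qed.

(** Commuting with [pid_mx m] is the matrix form of preserving the span of the first m coordinate
    vectors and its orthogonal complement. *)
Definition stabilizer_fixed (R : realType) m n d (u : tensor R n d) : Prop :=
  forall h : 'M[R]_n, orthogonal_mx h -> h *m pid_mx m = pid_mx m *m h ->
    move_tensor h u = u.

Lemma monomial_fixed (R : realType) m n d (u : tensor R n d)
    (s : 'I_n -> R) (pi : 'S_n) :
  stabilizer_fixed m u -> (forall b, s b * s b = 1) ->
  (forall b, (pi b < m)%N = (b < m)%N) ->
  forall j, u j = u [ffun t => pi (j t)] * \prod_(t < d) s (j t).
Proof.
move=> ufix ss pim j; rewrite -monomial_move ufix //.
  apply/matrixP => a b; rewrite !mxE.
  rewrite (bigD1 ((pi^-1)%g a)) //= [X in _ + X]big1 ?addr0.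
    by rewrite !mxE permKV eqxx mulr1 mulrA ss mul1r eq_sym.
  by move=> c /eqP ca; rewrite !mxE (_ : (a == pi c) = false) ?mulr0 ?mul0r //;
    apply/eqP => e; apply: ca; rewrite e permK.
apply/matrixP => a b; rewrite !mxE (bigD1 b) //= [X in _ + X]big1 ?addr0.
  rewrite [RHS](bigD1 a) //= [X in _ = _ + X]big1 ?addr0.
    rewrite !mxE !eqxx /=; case: (a =P pi b) => [->|_]; last by rewrite !mulr0 mul0r.
    by rewrite pim mulrC.
  by move=> c ca; rewrite !mxE eq_sym -val_eqE /= in ca *; rewrite (negPf ca) mul0r.
by move=> c cb; rewrite !mxE -val_eqE /= in cb *; rewrite (negPf cb) mulr0.
Qed.

(** Negating coordinate p belongs to the stabilizer; hence a nonzero component uses each index value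
    an even number of times. *)
Lemma sign_fixed (R : realType) m n d (u : tensor R n d) (p : 'I_n) :
  stabilizer_fixed m u ->
  forall j, u j = u j * \prod_(t < d) (if j t == p then -1 else 1).
Proof.
move=> ufix j; rewrite {1}(monomial_fixed (s := fun b => if b == p then -1 else 1)
  (pi := 1%g) ufix) //.
- by congr (u _ * _); apply/ffunP => t; rewrite ffunE perm1.
- by move=> b; case: ifP; rewrite ?mulrNN mulr1.
- by move=> b; rewrite perm1.
Qed.

Lemma tperm_fixed (R : realType) m n d (u : tensor R n d) (p q : 'I_n) :
  stabilizer_fixed m u -> (p < m)%N = (q < m)%N ->
  forall j, u j = u [ffun t => tperm p q (j t)].
Proof.
move=> ufix pq j; rewrite {1}(monomial_fixed (s := fun=> 1)
  (pi := tperm p q) ufix) ?big1 ?mulr1 //.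
by move=> b; case: tpermP => // ->.
Qed.

(** * Components of tensors of degrees 2 and 4 *)

Definition idx2 n (a b : 'I_n) : {ffun 'I_2 -> 'I_n} :=
  [ffun t : 'I_2 => nth a [:: a; b] t].
Definition idx4 n (a b c d : 'I_n) : {ffun 'I_4 -> 'I_n} :=
  [ffun t : 'I_4 => nth a [:: a; b; c; d] t].

Lemma sum_idx2 (R : realType) n (F : {ffun 'I_2 -> 'I_n} -> R) :
  \sum_i F i = \sum_a \sum_b F (idx2 a b).
Proof.
rewrite pair_bigA /= (reindex (fun ab => idx2 ab.1 ab.2)) //=.
exists (fun i => (i (@Ordinal 2 0 isT), i (@Ordinal 2 1 isT))) => [[a b] _|i _].
  by rewrite !ffunE.
by apply/ffunP; case=> -[|[|]] // l; rewrite ffunE /=; congr (i _); apply: val_inj.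
Qed.

Lemma sum_idx4 (R : realType) n (F : {ffun 'I_4 -> 'I_n} -> R) :
  \sum_i F i = \sum_a \sum_b \sum_c \sum_d F (idx4 a b c d).
Proof.
under [RHS]eq_bigr => a _ do under eq_bigr => b _ do rewrite pair_bigA.
under [RHS]eq_bigr => a _ do rewrite pair_bigA.
rewrite pair_bigA /=.
rewrite (reindex (fun x => idx4 x.1 x.2.1 x.2.2.1 x.2.2.2)) //=.
exists (fun i => (i (@Ordinal 4 0 isT), (i (@Ordinal 4 1 isT),
  (i (@Ordinal 4 2 isT), i (@Ordinal 4 3 isT))))) => [[a [b [c d]]] _|i _].
  by rewrite !ffunE.
by apply/ffunP; case=> -[|[|[|[|]]]] // l; rewrite ffunE /=; congr (i _);
  apply: val_inj.
Qed.

Lemma tensor2P (R : realType) n (u v : tensor R n 2) :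
  (forall a b, u (idx2 a b) = v (idx2 a b)) -> u = v.
Proof.
move=> uv; apply/ffunP => i.
have -> : i = idx2 (i (@Ordinal 2 0 isT)) (i (@Ordinal 2 1 isT)); last exact: uv.
by apply/ffunP; case=> -[|[|]] // l; rewrite ffunE /=; congr (i _); apply: val_inj.
Qed.

Lemma tensor4P (R : realType) n (u v : tensor R n 4) :
  (forall a b c d, u (idx4 a b c d) = v (idx4 a b c d)) -> u = v.
Proof.
move=> uv; apply/ffunP => i.
have -> : i = idx4 (i (@Ordinal 4 0 isT)) (i (@Ordinal 4 1 isT))
  (i (@Ordinal 4 2 isT)) (i (@Ordinal 4 3 isT)); last exact: uv.
by apply/ffunP; case=> -[|[|[|[|]]]] // l; rewrite ffunE /=; congr (i _);
  apply: val_inj.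
Qed.

Lemma prod_ord2 (R : realType) (f : 'I_2 -> R) :
  \prod_t f t = f (@Ordinal 2 0 isT) * f (@Ordinal 2 1 isT).
Proof.
rewrite !big_ord_recl big_ord0 mulr1; congr (_ * _); congr f; exact: val_inj.
Qed.

Lemma prod_ord4 (R : realType) (f : 'I_4 -> R) :
  \prod_t f t = f (@Ordinal 4 0 isT) * f (@Ordinal 4 1 isT) *
    f (@Ordinal 4 2 isT) * f (@Ordinal 4 3 isT).
Proof.
rewrite !big_ord_recl big_ord0 mulr1 -!mulrA.
by do ![congr (_ * _)]; congr f; exact: val_inj.
Qed.

Lemma map_idx2 n (f : 'I_n -> 'I_n) a b :
  [ffun t => f (idx2 a b t)] = idx2 (f a) (f b).
Proof. by apply/ffunP; case=> -[|[|]] // l; rewrite !ffunE. Qed.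

Lemma map_idx4 n (f : 'I_n -> 'I_n) a b c d :
  [ffun t => f (idx4 a b c d t)] = idx4 (f a) (f b) (f c) (f d).
Proof. by apply/ffunP; case=> -[|[|[|[|]]]] // l; rewrite !ffunE. Qed.

Lemma move_idx2 (R : realType) n (g : 'M[R]_n) (u : tensor R n 2) a b :
  move_tensor g u (idx2 a b) =
  \sum_a' (\sum_b' u (idx2 a' b') * g b' b) * g a' a.
Proof.
rewrite ffunE sum_idx2; apply: eq_bigr => a' _; rewrite mulr_suml.
by apply: eq_bigr => b' _; rewrite prod_ord2 !ffunE /=; ring.
Qed.

(** The sums are nested, with one factor of g outside each, so that [reflection_fixed] can collapse
    them one at a time from the inside. *)
Lemma move_idx4 (R : realType) n (g : 'M[R]_n) (u : tensor R n 4) a b c d :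
  move_tensor g u (idx4 a b c d) =
  \sum_a' (\sum_b' (\sum_c' (\sum_d' u (idx4 a' b' c' d') * g d' d)
    * g c' c) * g b' b) * g a' a.
Proof.
rewrite ffunE sum_idx4; apply: eq_bigr => a' _; rewrite mulr_suml.
apply: eq_bigr => b' _; rewrite 2!mulr_suml; apply: eq_bigr => c' _.
rewrite 3!mulr_suml; apply: eq_bigr => d' _.
by rewrite prod_ord4 !ffunE /=; ring.
Qed.

Definition proj_tensor2 (R : realType) n (P : 'M[R]_n) : tensor R n 2 :=
  [ffun i : {ffun 'I_2 -> 'I_n} =>
    P (i (@Ordinal 2 0 isT)) (i (@Ordinal 2 1 isT))].

(** Each factor fills two consecutive slots, that is, one row of the diagram of shape (2, 2). *)
Definition proj_tensor4 (R : realType) n (P : 'M[R]_n) : tensor R n 4 :=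
  [ffun i : {ffun 'I_4 -> 'I_n} =>
    P (i (@Ordinal 4 0 isT)) (i (@Ordinal 4 1 isT)) *
    P (i (@Ordinal 4 2 isT)) (i (@Ordinal 4 3 isT))].

Lemma mulmx_conjE (R : realType) n (g P : 'M[R]_n) a b :
  (g^T *m P *m g) a b = \sum_c \sum_d P c d * g c a * g d b.
Proof.
rewrite mxE exchange_big; apply: eq_bigr => d _.
rewrite mxE mulr_suml; apply: eq_bigr => c _.
by rewrite mxE; ring.
Qed.

Lemma move_proj_tensor2 (R : realType) n (g P : 'M[R]_n) :
  move_tensor g (proj_tensor2 P) = proj_tensor2 (g^T *m P *m g).
Proof.
apply: tensor2P => a b; rewrite move_idx2 !ffunE /= mulmx_conjE.
apply: eq_bigr => c _; rewrite mulr_suml; apply: eq_bigr => d _.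
by rewrite !ffunE /= mulrAC.
Qed.

Lemma move_proj_tensor4 (R : realType) n (g P : 'M[R]_n) :
  move_tensor g (proj_tensor4 P) = proj_tensor4 (g^T *m P *m g).
Proof.
apply: tensor4P => a b c d; rewrite move_idx4 [RHS]ffunE !ffunE /= !mulmx_conjE.
rewrite mulr_suml; apply: eq_bigr => a' _; rewrite !mulr_suml.
apply: eq_bigr => b' _; rewrite mulr_sumr 2!mulr_suml; apply: eq_bigr => c' _.
rewrite mulr_sumr 3!mulr_suml; apply: eq_bigr => d' _.
by rewrite !ffunE /=; ring.
Qed.

Lemma tdot_proj_tensor2 (R : realType) n (u : tensor R n 2) (P : 'M[R]_n) :
  tdot u (proj_tensor2 P) = \sum_a \sum_b u (idx2 a b) * P a b.
Proof.
rewrite /tdot sum_idx2; apply: eq_bigr => a _; apply: eq_bigr => b _.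
by rewrite !ffunE.
Qed.

Lemma tdot_proj_tensor4 (R : realType) n (u : tensor R n 4) (P : 'M[R]_n) :
  tdot u (proj_tensor4 P) =
  \sum_a \sum_b \sum_c \sum_d u (idx4 a b c d) * (P a b * P c d).
Proof.
rewrite /tdot sum_idx4; apply: eq_bigr => a _; apply: eq_bigr => b _.
by apply: eq_bigr => c _; apply: eq_bigr => d _; rewrite !ffunE.
Qed.

Lemma sum_pid (R : realType) m n (f : 'I_n -> 'I_n -> R) :
  \sum_a \sum_b f a b * (pid_mx m : 'M[R]_n) a b = \sum_(a < n | (a < m)%N) f a a.
Proof.
rewrite [RHS]big_mkcond; apply: eq_bigr => a _.
rewrite (bigD1 a) //= [X in _ + X]big1 ?addr0.
  by rewrite mxE eqxx /=; case: (a < m)%N; rewrite ?mulr1 ?mulr0.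
by move=> b; rewrite mxE -val_eqE eq_sym /= => /negPf ->; rewrite mulr0.
Qed.

Lemma sum_eq_const0 (R : realType) n (X : pred 'I_n) (f : 'I_n -> R) i :
  X i -> (forall j, X j -> f j = f i) -> \sum_(j | X j) f j = 0 -> f i = 0.
Proof.
move=> Xi fi; rewrite (eq_bigr _ fi) sumr_const => /eqP.
rewrite mulrn_eq0 => /orP[/eqP/card0_eq/(_ i)|/eqP //].
by rewrite unfold_in Xi.
Qed.

(** Sign changes kill the off-diagonal components, and transpositions make the diagonal constant on
    each block. Orthogonality to the projection then kills the first block, and the trace kills the
    second. *)
Lemma weyl2_unique (R : realType) m n (u : tensor R n 2) :
  @weyl_module R n [:: 2] u -> stabilizer_fixed m u ->
  tdot u (proj_tensor2 (pid_mx m)) = 0 -> u = 0.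
Proof.
move=> [tr _] ufix; rewrite tdot_proj_tensor2 sum_pid => u0.
have uoff a b : a != b -> u (idx2 a b) = 0.
  move=> ab; have := sign_fixed a ufix (idx2 a b).
  rewrite prod_ord2 !ffunE /= eqxx eq_sym (negPf ab) mulr1 mulrN1 => /eqP.
  by rewrite -addr_eq0 -mulr2n mulrn_eq0 /= => /eqP.
have uinv (a b : 'I_n) : (a < m)%N = (b < m)%N -> u (idx2 a a) = u (idx2 b b).
  by move=> ab; rewrite (tperm_fixed ufix ab) map_idx2 tpermL.
have uA (a : 'I_n) : (a < m)%N -> u (idx2 a a) = 0.
  move=> am; apply: (sum_eq_const0 (X := fun a : 'I_n => (a < m)%N)
    (f := fun a => u (idx2 a a)) am) => //.
  by move=> j jm; apply: uinv; rewrite am jm.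
have trace : \sum_a u (idx2 a a) = 0.
  (* The trace condition is stated at an index function, which requires n > 0. *)
  have [n0|[i0 _]] : (forall i : 'I_n, False) \/ exists i : 'I_n, True.
    by case: (n) => [|n']; [left => -[] | right; exists ord0].
    by apply: big1 => i; case: (n0 i).
  rewrite -[RHS](tr (@Ordinal 2 0 isT) (@Ordinal 2 1 isT) (idx2 i0 i0) isT).
  apply: eq_bigr => x _; congr (u _); apply/ffunP.
  by case=> -[|[|]] // l; rewrite !ffunE.
have uB (a : 'I_n) : ~~ (a < m)%N -> u (idx2 a a) = 0.
  move=> am; apply: (sum_eq_const0 (X := fun a : 'I_n => ~~ (a < m)%N)
     (f := fun a => u (idx2 a a)) am).
    by move=> j jm; apply: uinv; rewrite (negPf am) (negPf jm).
  by move: trace; rewrite (bigID (fun a : 'I_n => (a < m)%N)) /= u0 add0r.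
apply: tensor2P => a b; rewrite [RHS]ffunE.
have [<-|/uoff //] := eqVneq a b.
by case: (boolP (a < m)%N) => [/uA|/uB].
Qed.

(** Four indices that do not form two equal pairs contain a value of odd multiplicity; negating that
    coordinate changes the sign of the component. *)
Lemma stabilizer_fixed_offpair (R : realType) m n (u : tensor R n 4) a b c d :
  stabilizer_fixed m u ->
  [\/ u (idx4 a b c d) = 0, a = b /\ c = d, a = c /\ b = d | a = d /\ b = c].
Proof.
move=> ufix.
have neg (x : R) : x = - x -> x = 0.
  by move=> /eqP; rewrite -addr_eq0 -mulr2n mulrn_eq0 /= => /eqP.
have su p : u (idx4 a b c d) = u (idx4 a b c d) *
    ((if a == p then -1 else 1) * (if b == p then -1 else 1) *
     (if c == p then -1 else 1) * (if d == p then -1 else 1)).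
  by have := sign_fixed p ufix (idx4 a b c d); rewrite prod_ord4 !ffunE.
have [ab|ab] := eqVneq b a.
  have [dc|dc] := eqVneq d c; first by constructor 2.
  constructor 1; apply: neg; rewrite {1}(su c) ab eqxx (negPf dc).
  by case: ifP; rewrite ?mulrNN ?mulr1 ?mul1r ?mulrN1.
have [ac|ac] := eqVneq c a.
  have [db|db] := eqVneq d b; first by constructor 3.
  constructor 1; apply: neg; rewrite {1}(su b) ac eqxx (negPf db).
  by case: ifP; rewrite ?mulrNN ?mulr1 ?mul1r ?mulrN1 ?opprK.
have [ad|ad] := eqVneq d a.
  have [cb|cb] := eqVneq c b; first by constructor 4.
  constructor 1; apply: neg; rewrite {1}(su b) ad eqxx (negPf cb).
  by case: ifP; rewrite ?mulrNN ?mulr1 ?mul1r ?mulrN1 ?opprK.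
constructor 1; apply: neg; rewrite {1}(su a) eqxx (negPf ab) (negPf ac) (negPf ad).
by rewrite !mulr1 mulrN1.
Qed.

(** With x the common value off i, and N the number of elements other than i, the sum is (kap + N)
    x. For N > 0 the factor is positive; for N = 0 the sum is f i itself. *)
Lemma block_vanish (R : realType) n (X : pred 'I_n) (f : 'I_n -> R) i (kap : R) :
  X i -> 0 <= kap -> \sum_(j | X j) f j = 0 ->
  (forall j j', X j -> X j' -> j != i -> j' != i -> f j = f j') ->
  (forall j, X j -> j != i -> f i = kap * f j) ->
  forall j, X j -> f j = 0.
Proof.
move=> Xi k0 f0 fc fk.
have fj j : X j -> j != i -> f j = 0.
  move=> Xj ji; move: f0; rewrite (bigD1 i) //= (fk j) //.
  rewrite (eq_bigr (fun=> f j)); last by move=> l /andP[Xl li]; apply: fc.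
  rewrite sumr_const -mulr_natl -mulrDl => /eqP; rewrite mulf_eq0.
  case/orP=> [|/eqP //]; rewrite paddr_eq0 // => /andP[_].
  rewrite pnatr_eq0 => /eqP/card0_eq/(_ j).
  by rewrite unfold_in Xj ji.
move=> j Xj; have [->|/fj //] := eqVneq j i; last exact.
move: f0; rewrite (bigD1 i) //= big1 ?addr0 // => l /andP[]; exact: fj.
Qed.

(** Used with M i j = u (i, i, j, j). Within the first block all partial row sums agree, so the
    vanishing total makes each of them 0 and [block_vanish] clears that block. The full row sums
    then clear the mixed blocks and, by symmetry, reduce the last block to [block_vanish] again. *)
Lemma block_matrix_vanish (R : realType) m n (M : 'I_n -> 'I_n -> R) (kap : R) :
  0 <= kap ->
  (forall p q i j : 'I_n, (p < m)%N = (q < m)%N ->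
     M i j = M (tperm p q i) (tperm p q j)) ->
  (forall i j, M i j = M j i) ->
  (forall i, \sum_j M i j = 0) ->
  (forall i j : 'I_n, i != j -> (i < m)%N = (j < m)%N -> M i i = kap * M i j) ->
  \sum_(i < n | (i < m)%N) \sum_(j < n | (j < m)%N) M i j = 0 ->
  forall i j, M i j = 0.
Proof.
move=> k0 Minv Msym Mrow Mk MA.
have Mc (i j j' : 'I_n) : j != i -> j' != i -> (j < m)%N = (j' < m)%N -> M i j = M i j'.
  by move=> ji j'i jj'; rewrite (Minv j j') // tpermL tpermD.
have tpm (p q i : 'I_n) : (p < m)%N = (q < m)%N -> (tperm p q i < m)%N = (i < m)%N.
  by move=> pq; case: tpermP => // ->.
have sA (i : 'I_n) : (i < m)%N -> \sum_(j < n | (j < m)%N) M i j = 0.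
  move=> im; apply: (sum_eq_const0 (X := fun a : 'I_n => (a < m)%N)
    (f := fun i => \sum_(j < n | (j < m)%N) M i j) im) => // j jm.
  have ij : (i < m)%N = (j < m)%N by rewrite im jm.
  rewrite [RHS](reindex_perm (tperm i j)) /=; apply: eq_big => [l|l _].
    by rewrite tpm.
  by rewrite (Minv i j) // tpermR.
have MAA (i j : 'I_n) : (i < m)%N -> (j < m)%N -> M i j = 0.
  move=> im jm; apply: (block_vanish (X := fun j : 'I_n => (j < m)%N)
    (f := M i) im k0) => //; first exact: sA.
    by move=> a b am bm ai bi; apply: Mc; rewrite ?am ?bm.
  by move=> a am ai; apply: Mk; rewrite 1?eq_sym // im am.
have MAB (i j : 'I_n) : (i < m)%N -> ~~ (j < m)%N -> M i j = 0.
  move=> im jm; apply: (sum_eq_const0 (X := fun j : 'I_n => ~~ (j < m)%N)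
     (f := M i) jm).
    move=> a am; have ni (b : 'I_n) : ~~ (b < m)%N -> b != i.
      by apply: contraNneq => ->.
    by apply: Mc; rewrite ?ni // (negPf am) (negPf jm).
  by have := Mrow i; rewrite (bigID (fun a : 'I_n => (a < m)%N)) /= sA // add0r.
have MBB (i j : 'I_n) : ~~ (i < m)%N -> ~~ (j < m)%N -> M i j = 0.
  move=> im jm; apply: (block_vanish (X := fun j : 'I_n => ~~ (j < m)%N)
    (f := M i) im k0) => //.
  - have := Mrow i; rewrite (bigID (fun a : 'I_n => (a < m)%N)) /=.
    by rewrite big1 ?add0r // => a am; rewrite Msym MAB.
  - by move=> a b am bm ai bi; apply: Mc; rewrite ?(negPf am) ?(negPf bm).
  - by move=> a am ai; apply: Mk; rewrite 1?eq_sym // (negPf im) (negPf am).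
move=> i j; case: (boolP (i < m)%N) => im; case: (boolP (j < m)%N) => jm.
- exact: MAA.
- exact: MAB.
- by rewrite Msym MAB.
- exact: MBB.
Qed.

(* Invariance under the 3-4-5 reflection in the plane of [e_p] and [e_q], read
   off at the component (p, p, p, p). *)
Lemma reflection_fixed (R : realType) m n (u : tensor R n 4) (p q : 'I_n) :
  stabilizer_fixed m u -> p != q -> (p < m)%N = (q < m)%N ->
  2%:R * u (idx4 p p p p) =
  u (idx4 p p q q) + u (idx4 p q p q) + u (idx4 p q q p) +
  u (idx4 q p p q) + u (idx4 q p q p) + u (idx4 q q p p).
Proof.
move=> ufix pq pqm.
have qpF : (q == p) = false by rewrite eq_sym (negPf pq).
(* The reflection along e_p - 2 e_q sends e_p to 3/5 e_p + 4/5 e_q, so no square roots occur. *)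
pose v : 'rV[R]_n := \row_i ((i == p)%:R - 2%:R * (i == q)%:R).
have two (f : 'I_n -> R) x y :
    \sum_a f a * (x * (a == p)%:R + y * (a == q)%:R) = x * f p + y * f q.
  rewrite (bigD1 p) //= (bigD1 q) ?qpF //= !eqxx (negPf pq).
  rewrite big1 /=; first by ring.
  by move=> i /andP[/negPf -> /negPf ->]; rewrite !mulr0 addr0 mulr0.
have vv : v *m v^T = 5%:R%:M.
  apply/matrixP => i j; rewrite !ord1 !mxE /=.
  under eq_bigr => a _ do rewrite !mxE -mulNr -[X in _ * (X + _)]mul1r.
  rewrite (two (fun a => (a == p)%:R + - 2%:R * (a == q)%:R)).
  by rewrite !eqxx (negPf pq) qpF /= ?mulr1n; ring.
pose h : 'M[R]_n := 1%:M - (2%:R / 5%:R) *: (v^T *m v).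
have hT : h^T = h by rewrite /h linearB linearZ /= trmx1 trmx_mul trmxK.
have hO : orthogonal_mx h.
  rewrite /orthogonal_mx hT /h mulmxBl mul1mx mulmxBr mulmx1.
  rewrite -scalemxAl -scalemxAr mulmxA -[v^T *m v *m v^T]mulmxA vv.
  rewrite mul_mx_scalar -scalemxAl !scalerA -addrA -opprD.
  rewrite (_ : 2 / 5 * (2 / 5 * 5) = 2 / 5 + 2 / 5 :> R); last by field.
  by rewrite scalerDl addrA subrr subr0.
(* As p and q lie in the same block, v is an eigenvector of the projection, so the reflection
   commutes with it. *)
have vP : v *m pid_mx m = (p < m)%:R *: v.
  apply/rowP => i; rewrite !mxE (bigD1 i) //= [X in _ + X]big1 ?addr0.
    rewrite !mxE eqxx /=.
    have [->|ip] := eqVneq i p; first by rewrite mulrC.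
    have [->|iq] := eqVneq i q; first by rewrite pqm mulrC.
    by rewrite mulr0 subrr mulr0 mul0r.
  by move=> j ji; rewrite !mxE -val_eqE /= in ji *; rewrite (negPf ji) mulr0.
have Pv : pid_mx m *m v^T = (p < m)%:R *: v^T.
  by rewrite -[LHS]trmxK trmx_mul trmxK tr_pid_mx vP linearZ.
have hP : h *m pid_mx m = pid_mx m *m h.
  rewrite /h mulmxBl mulmxBr mul1mx mulmx1 -scalemxAl -scalemxAr.
  by congr (_ - _ *: _); rewrite -mulmxA vP -scalemxAr mulmxA Pv -scalemxAl.
have hp a : h a p = 3 / 5 * (a == p)%:R + 4 / 5 * (a == q)%:R.
  rewrite !mxE big_ord1 !mxE eqxx (negPf pq) /=.
  by case: (a == p); case: (a == q) => /=; field.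
have := move_idx4 h u p p p p; rewrite ufix //.
under eq_bigr => a _ do (under eq_bigr => b _ do
  (under eq_bigr => c _ do (under eq_bigr => d _ do rewrite hp);
   under eq_bigr => c _ do rewrite two hp);
  under eq_bigr => b _ do rewrite two hp).
under eq_bigr => a _ do rewrite two hp.
rewrite two.
have z a b c d : ~ (a = b /\ c = d) -> ~ (a = c /\ b = d) -> ~ (a = d /\ b = c) ->
    u (idx4 a b c d) = 0.
  by move=> n1 n2 n3; case: (stabilizer_fixed_offpair a b c d ufix).
have qp : q <> p by apply/eqP; rewrite eq_sym.
have pq' := elimN eqP pq.
have -> : u (idx4 q q q q) = u (idx4 p p p p).
  by rewrite (tperm_fixed ufix pqm) map_idx4 tpermR.
rewrite (z p p p q) 1?(z p p q p) 1?(z p q p p) 1?(z q p p p); try by case.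
rewrite (z q q q p) 1?(z q q p q) 1?(z q p q q) 1?(z p q q q); try by case.
(* The two pure components carry 3^4/5^4 + 4^4/5^4 = 337/625 and each of the six mixed ones 144/625;
   the factor 2 is (625 - 337)/144. *)
move=> H; lra.
Qed.

(** * Fixed tensors in the Weyl modules of shapes (4) and (2, 2) *)

Lemma permute_tensorM (R : realType) n d (p q : 'S_d) (w : tensor R n d) :
  permute_tensor p (permute_tensor q w) = permute_tensor (q * p)%g w.
Proof.
apply/ffunP => i; rewrite !ffunE; congr (w _); apply/ffunP => t.
by rewrite !ffunE permM.
Qed.

Lemma permute_tensor_sum (R : realType) n d (p : 'S_d) (I : finType) (A : pred I)
    (w : I -> tensor R n d) :
  permute_tensor p (\sum_(x | A x) w x) = \sum_(x | A x) permute_tensor p (w x).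
Proof.
apply/ffunP => i; rewrite ffunE !tensor_sumE; apply: eq_bigr => x _.
by rewrite ffunE.
Qed.

(** [young_symmetrizer] applies the row permutations last, so one more of them only reindexes the
    outer sum. *)
Lemma permute_young_symmetrizer (R : realType) n lam p
    (w : tensor R n (sumn lam)) :
  p \in row_stab lam ->
  permute_tensor p (young_symmetrizer w) = young_symmetrizer w.
Proof.
rewrite inE => /forallP pr; rewrite permute_tensor_sum /young_symmetrizer.
rewrite [RHS](reindex_inj (mulIg p)) /=; apply: eq_big => [p'|p' _].
  rewrite !inE; apply/forallP/forallP => H t; have := H t; rewrite permM.
    by rewrite (eqP (pr _)).
  by rewrite (eqP (pr _)).
rewrite permute_tensor_sum; apply: eq_bigr => q _.
have := permute_tensor_lin p ((-1) ^+ q) (permute_tensor p' (permute_tensor q w)) 0.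
rewrite (_ : permute_tensor p 0 = 0) ?addr0; last by apply/ffunP => i; rewrite !ffunE.
by move=> ->; rewrite !permute_tensorM mulgA.
Qed.

Local Notation t0 := (@Ordinal 4 0 isT).
Local Notation t1 := (@Ordinal 4 1 isT).
Local Notation t2 := (@Ordinal 4 2 isT).
Local Notation t3 := (@Ordinal 4 3 isT).

Lemma permute_idx4 (R : realType) n (p : 'S_4) (w : tensor R n 4) i :
  permute_tensor p w i = w (idx4 (i (p t0)) (i (p t1)) (i (p t2)) (i (p t3))).
Proof.
rewrite ffunE; congr (w _); apply/ffunP.
by case=> -[|[|[|[|]]]] // l; rewrite !ffunE /=; congr (i (p _)); apply: val_inj.
Qed.

Lemma traceless_idx4_23 (R : realType) n (u : tensor R n 4) a :
  traceless u -> \sum_x u (idx4 a a x x) = 0.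
Proof.
move=> tr; rewrite -[RHS](tr t2 t3 (idx4 a a a a) isT).
apply: eq_bigr => x _; congr (u _); apply/ffunP.
by case=> -[|[|[|[|]]]] // l; rewrite !ffunE.
Qed.

Lemma traceless_idx4_13 (R : realType) n (u : tensor R n 4) a :
  traceless u -> \sum_x u (idx4 a x a x) = 0.
Proof.
move=> tr; rewrite -[RHS](tr t1 t3 (idx4 a a a a) isT).
apply: eq_bigr => x _; congr (u _); apply/ffunP.
by case=> -[|[|[|[|]]]] // l; rewrite !ffunE.
Qed.

Lemma traceless_idx4_12 (R : realType) n (u : tensor R n 4) a :
  traceless u -> \sum_x u (idx4 a x x a) = 0.
Proof.
move=> tr; rewrite -[RHS](tr t1 t2 (idx4 a a a a) isT).
apply: eq_bigr => x _; congr (u _); apply/ffunP.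
by case=> -[|[|[|[|]]]] // l; rewrite !ffunE.
Qed.

Lemma tdot_pid4 (R : realType) m n (u : tensor R n 4) :
  tdot u (proj_tensor4 (pid_mx m)) =
  \sum_(i < n | (i < m)%N) \sum_(j < n | (j < m)%N) u (idx4 i i j j).
Proof.
rewrite tdot_proj_tensor4.
transitivity (\sum_a \sum_b (\sum_c \sum_d u (idx4 a b c d) *
    (pid_mx m : 'M[R]_n) c d) * (pid_mx m : 'M[R]_n) a b).
  apply: eq_bigr => a _; apply: eq_bigr => b _; rewrite mulr_suml.
  apply: eq_bigr => c _; rewrite mulr_suml; apply: eq_bigr => d _; ring.
by rewrite sum_pid; apply: eq_bigr => i _; rewrite sum_pid.
Qed.

(** Common core of both shapes: their symmetries express every paired component through the matrix
    of components (i, i, j, j). The constant kap is the ratio of a diagonal entry to the other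
    entries of its row in the same block. *)
Lemma tensor4_unique (R : realType) m n (u : tensor R n 4) (kap c1 c2 : R) :
  traceless u -> stabilizer_fixed m u ->
  tdot u (proj_tensor4 (pid_mx m)) = 0 -> 0 <= kap ->
  (forall i j, u (idx4 i i j j) = u (idx4 j j i i)) ->
  (forall i j : 'I_n, i != j -> (i < m)%N = (j < m)%N ->
     u (idx4 i i i i) = kap * u (idx4 i i j j)) ->
  (forall i j, u (idx4 i j i j) = c1 * u (idx4 i i j j)) ->
  (forall i j, u (idx4 i j j i) = c2 * u (idx4 i i j j)) ->
  u = 0.
Proof.
move=> tr ufix u0 k0 usym uk u1 u2.
have M0 : forall i j, u (idx4 i i j j) = 0.
  apply: (block_matrix_vanish (m := m) (M := fun i j => u (idx4 i i j j)) k0) => //.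
  - by move=> p q i j pq; rewrite (tperm_fixed ufix pq) map_idx4.
  - by move=> i; apply: traceless_idx4_23.
  - by rewrite -tdot_pid4.
apply: tensor4P => a b c d; rewrite [RHS]ffunE.
case: (stabilizer_fixed_offpair a b c d ufix) => // -[-> ->] //.
- by rewrite u1 M0 mulr0.
- by rewrite u2 M0 mulr0.
Qed.

Lemma weyl4_unique (R : realType) m n (u : tensor R n 4) :
  @weyl_module R n [:: 4] u -> stabilizer_fixed m u ->
  tdot u (proj_tensor4 (pid_mx m)) = 0 -> u = 0.
Proof.
move=> [tr [w wu]] ufix u0.
have sym (p : 'S_4) : permute_tensor p u = u.
  rewrite wu; apply: (@permute_young_symmetrizer R n [:: 4] p).
  rewrite inE; apply/forallP => t.
  have idx0 (x : 'I_4) : reshape_index [:: 4] x = 0%N.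
    by case: x => -[|[|[|[|]]]].
  by rewrite !idx0.
have sw a b c d : u (idx4 a b c d) = u (idx4 b a c d).
  rewrite -{1}(sym (tperm t0 t1)) permute_idx4 tpermL tpermR !tpermD //.
  by rewrite !ffunE.
have sw2 a b c d : u (idx4 a b c d) = u (idx4 a c b d).
  rewrite -{1}(sym (tperm t1 t2)) permute_idx4 tpermL tpermR !tpermD //.
  by rewrite !ffunE.
have sw3 a b c d : u (idx4 a b c d) = u (idx4 a b d c).
  rewrite -{1}(sym (tperm t2 t3)) permute_idx4 tpermL tpermR !tpermD //.
  by rewrite !ffunE.
have usym i j : u (idx4 i i j j) = u (idx4 j j i i).
  by rewrite sw2 sw sw3 sw2.
have u1 i j : u (idx4 i j i j) = u (idx4 i i j j) by rewrite sw2.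
have u2 i j : u (idx4 i j j i) = u (idx4 i i j j) by rewrite sw3 sw2.
(* Full symmetry makes the six terms of the reflection identity equal: 2 u (i, i, i, i) = 6 u (i, i,
   j, j). *)
apply: (tensor4_unique (kap := 3) (c1 := 1) (c2 := 1) tr ufix u0) => //.
- move=> i j ij ijm; have := reflection_fixed ufix ij ijm.
  have -> : u (idx4 j i i j) = u (idx4 i i j j) by rewrite sw u1.
  have -> : u (idx4 j i j i) = u (idx4 i i j j) by rewrite sw u2.
  by rewrite u1 u2 -usym; lra.
- by move=> i j; rewrite u1 mul1r.
- by move=> i j; rewrite u2 mul1r.
Qed.

(** Serves both rows and columns of the diagram (2, 2): the two fibres of f have two boxes each, and
    the stabilizer is generated by the swaps inside them. *)
Lemma sum_stab22 (V : nmodType) (f : 'I_4 -> nat) a b c d (F : 'S_4 -> V) :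
  uniq [:: a; b; c; d] -> (forall t, t \in [:: a; b; c; d]) ->
  f a = f b -> f c = f d -> f a != f c ->
  \sum_(p in [set p : 'S_4 | [forall t, f (p t) == f t]]%SET) F p =
  F 1%g + F (tperm a b) + F (tperm c d) + F (tperm a b * tperm c d)%g.
Proof.
rewrite /= !inE !negb_or !andbT.
move=> /and3P[/and3P[ab ac ad] /andP[bc bd] cd] cov fab fcd fac.
have fA t : f t = f a -> t = a \/ t = b.
  move=> ft; have := cov t; rewrite !inE => /or4P[]/eqP e; try by [left|right].
    by move: ft fac; rewrite e => ->; rewrite eqxx.
  by move: ft fac; rewrite e -fcd => ->; rewrite eqxx.
have fC t : f t = f c -> t = c \/ t = d.
  move=> ft; have := cov t; rewrite !inE => /or4P[]/eqP e; try by [left|right].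
    by move: ft fac; rewrite e => ->; rewrite eqxx.
  by move: ft fac; rewrite e -fab => ->; rewrite eqxx.
have neq : [/\ b != a, c != a & d != a] /\ [/\ c != b, d != b & d != c].
  by do ![split]; rewrite eq_sym.
case: neq => -[ba ca da] [cb db dc].
pose l : seq 'S_4 := [:: 1; tperm a b; tperm c d; tperm a b * tperm c d]%g.
have fx (p : 'S_4) : (forall t, f (p t) = f t) -> p \in l.
  move=> pf; pose ext (q : 'S_4) := [/\ p a = q a, p b = q b, p c = q c & p d = q d].
  have extP q : ext q -> p = q.
    move=> [ea eb ec ed]; apply/permP => t; have := cov t.
    by rewrite !inE => /or4P[]/eqP ->.
  have pne x y : x != y -> p x <> p y by move=> /eqP xy /perm_inj.
  have [pa|pa] := fA _ (pf a); have [pb|pb] := fA _ (etrans (pf b) (esym fab)).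
  - by have := pne _ _ ab; rewrite pa pb.
  - have [pc|pc] := fC _ (pf c); have [pd|pd] := fC _ (etrans (pf d) (esym fcd)).
    + by have := pne _ _ cd; rewrite pc pd.
    + rewrite (extP 1%g) ?mem_head //; by split; rewrite perm1.
    + rewrite (extP (tperm c d)) ?inE ?eqxx ?orbT //.
      by split; rewrite ?tpermL ?tpermR // tpermD // eq_sym.
    + by have := pne _ _ cd; rewrite pc pd.
  - have [pc|pc] := fC _ (pf c); have [pd|pd] := fC _ (etrans (pf d) (esym fcd)).
    + by have := pne _ _ cd; rewrite pc pd.
    + rewrite (extP (tperm a b)) ?inE ?eqxx ?orbT //.
      by split; rewrite ?tpermL ?tpermR // tpermD // eq_sym.
    + rewrite (extP (tperm a b * tperm c d)%g) ?inE ?eqxx ?orbT //.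
      split; rewrite permM.
      * by rewrite tpermL tpermD // eq_sym.
      * by rewrite tpermR tpermD // eq_sym.
      * by rewrite (@tpermD _ a b c) ?tpermL // eq_sym.
      * by rewrite (@tpermD _ a b d) ?tpermR // eq_sym.
    + by have := pne _ _ cd; rewrite pc pd.
  - by have := pne _ _ ab; rewrite pa pb.
have ft (x y t : 'I_4) : f x = f y -> f (tperm x y t) = f t.
  by move=> xy; case: tpermP => // ->.
rewrite -big_enum (perm_big l) /=.
  by rewrite !big_cons big_nil addr0 !addrA.
apply: uniq_perm; first exact: enum_uniq.
  (* The images of a and c already distinguish the four permutations. *)
  apply: (@map_uniq _ _ (fun p : 'S_4 => (p a, p c))).
  rewrite /= !permM !perm1 !tpermL !(@tpermD _ a b c) 1?eq_sym //.
  rewrite !(@tpermD _ c d a) 1?eq_sym // tpermL (@tpermD _ c d b) 1?eq_sym //.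
  by rewrite !inE !xpair_eqE !eqxx !negb_or (negPf ab) (negPf cd) (negPf ba).
move=> p; rewrite mem_enum inE; apply/forallP/idP => [pf|].
  by apply: fx => t; apply/eqP.
rewrite !inE => /or4P[]/eqP -> t; rewrite ?perm1 ?permM ?ft //.
Qed.

(** Here v antisymmetrizes w along the columns, slots (0, 2) and (1, 3), and u symmetrizes v along
    the rows, slots (0, 1) and (2, 3). *)
Lemma weyl22_explicit (R : realType) n (u : tensor R n 4) :
  @weyl_module R n [:: 2; 2] u ->
  exists w : 'I_n -> 'I_n -> 'I_n -> 'I_n -> R, forall a b c d,
    let v a b c d := w a b c d - w c b a d - w a d c b + w c d a b in
    u (idx4 a b c d) = v a b c d + v b a c d + v a b d c + v b a d c.
Proof.
move=> [_ [w ->]]; exists (fun a b c d => w (idx4 a b c d)) => a b c d /=.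
have cov t : t \in [:: t0; t1; t2; t3].
  by case: t => -[|[|[|[|]]]].
have cov' t : t \in [:: t0; t2; t1; t3].
  by case: t => -[|[|[|[|]]]].
rewrite /young_symmetrizer /row_stab /col_stab.
rewrite (@sum_stab22 _ (reshape_index [:: 2; 2]) t0 t1 t2 t3) //.
rewrite !(@sum_stab22 _ (reshape_offset [:: 2; 2]) t0 t2 t1 t3) //.
rewrite !odd_permM !odd_tperm odd_perm1 /= expr0 expr1.
have addE (x y : tensor R n 4) i : (x + y) i = x i + y i by rewrite ffunE.
have scaleE (r : R) (x : tensor R n 4) i : (r *: x) i = r * x i by rewrite ffunE.
have p1E (x : tensor R n 4) : permute_tensor 1%g x = x.
  apply: tensor4P => a' b' c' d'; rewrite permute_idx4 !perm1; congr (x _).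
  by rewrite !ffunE.
have p01 (x : tensor R n 4) a' b' c' d' :
    permute_tensor (tperm t0 t1) x (idx4 a' b' c' d') = x (idx4 b' a' c' d').
  by rewrite permute_idx4 tpermL tpermR !tpermD // !ffunE.
have p23 (x : tensor R n 4) a' b' c' d' :
    permute_tensor (tperm t2 t3) x (idx4 a' b' c' d') = x (idx4 a' b' d' c').
  by rewrite permute_idx4 tpermL tpermR !tpermD // !ffunE.
have p02 (x : tensor R n 4) a' b' c' d' :
    permute_tensor (tperm t0 t2) x (idx4 a' b' c' d') = x (idx4 c' b' a' d').
  by rewrite permute_idx4 tpermL tpermR !tpermD // !ffunE.
have p13 (x : tensor R n 4) a' b' c' d' :
    permute_tensor (tperm t1 t3) x (idx4 a' b' c' d') = x (idx4 a' d' c' b').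
  by rewrite permute_idx4 tpermL tpermR !tpermD // !ffunE.
rewrite -!permute_tensorM !p1E !(addE, scaleE) !(p01, p23, p02, p13).
ring.
Qed.

Lemma weyl22_unique (R : realType) m n (u : tensor R n 4) :
  @weyl_module R n [:: 2; 2] u -> stabilizer_fixed m u ->
  tdot u (proj_tensor4 (pid_mx m)) = 0 -> u = 0.
Proof.
move=> Wu ufix u0; have [w uE] := weyl22_explicit Wu; case: Wu => tr _.
(* Column antisymmetry kills u (i, i, i, i). Moreover u (i, i, j, j) = 4 v (i, i, j, j), while in u
   (i, j, i, j) and u (i, j, j, i) two of the four terms vanish and the other two equal - v (i, i,
   j, j); hence the ratio -1/2. *)
apply: (tensor4_unique (kap := 0) (c1 := - 2^-1) (c2 := - 2^-1) tr ufix u0) => //.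
- by move=> i j; rewrite !uE /=; ring.
- by move=> i j _ _; rewrite !uE /=; ring.
- by move=> i j; rewrite !uE /=; field.
- by move=> i j; rewrite !uE /=; field.
Qed.

(** * Pauli operators and their eigenspaces *)

Definition sgn (R : realType) (z : 'F_2) : R := (-1) ^+ (z : nat).

Lemma F2_cases (z : 'F_2) : z = 0 \/ z = 1.
Proof.
by case: z => -[|[|]] // l; [left | right]; apply: val_inj.
Qed.

Lemma addF2 (V : lmodType 'F_2) (x : V) : x + x = 0.
Proof.
have e : 1 + 1 = 0 :> 'F_2 by apply: val_inj.
by rewrite -[x]scale1r -scalerDl e scale0r.
Qed.

Lemma addF2_eq (V : lmodType 'F_2) (x y z : V) : (x == y + z) = (y == x + z).
Proof. by apply/eqP/eqP => ->; rewrite -addrA addF2 addr0. Qed.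

Lemma sgn0 (R : realType) : sgn R 0 = 1.
Proof. by []. Qed.

Lemma sgnD (R : realType) x y : sgn R (x + y) = sgn R x * sgn R y.
Proof.
by case: (F2_cases x) => ->; case: (F2_cases y) => ->; rewrite /sgn /=; ring.
Qed.

Lemma sgn_sqr (R : realType) x : sgn R x * sgn R x = 1.
Proof. by case: (F2_cases x) => ->; rewrite /sgn /=; ring. Qed.

Lemma sgn_inj (R : realType) : injective (@sgn R).
Proof.
move=> x y; case: (F2_cases x) => ->; case: (F2_cases y) => -> //;
  by rewrite /sgn /= expr0 expr1 => H; exfalso; lra.
Qed.

Lemma dotC k (a b : 'rV['F_2]_k) : dot a b = dot b a.
Proof. by rewrite /dot !mxE; apply: eq_bigr => i _; rewrite !mxE mulrC. Qed.

Lemma dotDl k (a b c : 'rV['F_2]_k) : dot (a + b) c = dot a c + dot b c.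
Proof. by rewrite /dot mulmxDl mxE. Qed.

Lemma dotDr k (a b c : 'rV['F_2]_k) : dot c (a + b) = dot c a + dot c b.
Proof. by rewrite !(dotC c) dotDl. Qed.

Lemma dotZl k x (a b : 'rV['F_2]_k) : dot (x *: a) b = x * dot a b.
Proof. by rewrite /dot -scalemxAl mxE. Qed.

Lemma dotZr k x (a b : 'rV['F_2]_k) : dot a (x *: b) = x * dot a b.
Proof. by rewrite !(dotC a) dotZl. Qed.

Lemma dot_delta k (a : 'rV['F_2]_k) i : dot (delta_mx 0 i) a = a 0 i.
Proof. by rewrite /dot -rowE !mxE. Qed.

Lemma dot0l k (a : 'rV['F_2]_k) : dot 0 a = 0.
Proof. by rewrite /dot mul0mx mxE. Qed.

(** Orthogonality of characters: if u has i-th coordinate 1, translating b by the i-th unit vector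
    negates the sum. *)
Lemma sum_sgn_dot (R : realType) k (u : 'rV['F_2]_k) :
  \sum_(b : 'rV['F_2]_k) sgn R (dot b u) = (2 ^ k)%:R * (u == 0)%:R.
Proof.
have [->|u0] := eqVneq u 0.
  rewrite (eq_bigr (fun=> 1)); last by move=> b _; rewrite dotC dot0l.
  by rewrite sumr_const card_F2 mulr1.
rewrite mulr0; have [i ui] : exists i, u 0 i != 0.
  apply: contrapT => /forallNP H; move/eqP: u0; apply; apply/rowP => i.
  by rewrite mxE; apply/eqP; apply: contrapT => /negP; exact: H.
have ui1 : dot (delta_mx 0 i) u = 1.
  by rewrite dot_delta; case: (F2_cases (u 0 i)) ui => ->.
set s := \sum_b _; suff : s = - s.
  by move=> /eqP; rewrite -addr_eq0 -mulr2n mulrn_eq0 /= => /eqP.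
rewrite /s [LHS](reindex_inj (addIr (delta_mx 0 i))) /= -sumrN.
by apply: eq_bigr => b _; rewrite dotDl ui1 sgnD {2}/sgn /= expr1 mulrN1.
Qed.

Lemma label_inj k : injective (@label k).
Proof. by move=> i j /enum_val_inj/cast_ord_inj. Qed.

Definition unlabel k (v : 'rV['F_2]_k) : 'I_(2 ^ k) :=
  cast_ord (card_F2 k) (enum_rank v).

Lemma unlabelK k : cancel (@unlabel k) (@label k).
Proof. by move=> v; rewrite /label /unlabel cast_ordK enum_rankK. Qed.

Lemma labelK k : cancel (@label k) (@unlabel k).
Proof. by move=> i; apply: label_inj; rewrite unlabelK. Qed.

Lemma sum_label (R : realType) k (f : 'rV['F_2]_k -> R) :
  \sum_i f (label i) = \sum_v f v.
Proof.
rewrite [RHS](reindex (@label k)) //; exists (@unlabel k) => x _.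
  exact: labelK.
exact: unlabelK.
Qed.

Definition pauli (R : realType) k (x : F2pairs k) : 'M[R]_(2 ^ k) :=
  opY R x.2 *m opX R x.1.

Lemma pauliE (R : realType) k (x : F2pairs k) i j :
  pauli R x i j = sgn R (dot x.2 (label i)) * (label j == label i + x.1)%:R.
Proof.
rewrite mxE (bigD1 i) //= [X in _ + X]big1 ?addr0.
  by rewrite !mxE eqxx.
by move=> l; rewrite !mxE eq_sym => /negPf ->; rewrite mulr0n mul0r.
Qed.

Lemma pauli0 (R : realType) k : pauli R (0 : F2pairs k) = 1%:M.
Proof.
apply/matrixP => i j; rewrite pauliE /= dot0l sgn0 mul1r addr0 mxE eq_sym.
by rewrite (inj_eq (@label_inj k)).
Qed.

(** The sign is the cocycle of the lift [pauli] to E; [quad] is built to absorb it on an isotropic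
    subspace. *)
Lemma pauliM (R : realType) k (x y : F2pairs k) :
  pauli R x *m pauli R y = sgn R (dot x.1 y.2) *: pauli R (x + y).
Proof.
apply/matrixP => i j.
have xyE : pauli R (x + y) i j = sgn R (dot x.2 (label i)) *
    sgn R (dot y.2 (label i)) * (label j == label i + x.1 + y.1)%:R.
  by rewrite pauliE -sgnD -dotDl -addrA.
rewrite [LHS]mxE (bigD1 (unlabel (label i + x.1))) //=.
rewrite [X in _ + X]big1 ?addr0; last first.
  move=> l li; rewrite !pauliE (_ : (label l == _) = false) ?mulr0 ?mul0r //.
  by apply: contraNF li => /eqP <-; rewrite labelK.
rewrite [RHS]mxE xyE !pauliE unlabelK eqxx dotDr sgnD (dotC y.2 x.1) /=; ring.
Qed.

Lemma tr_pauli (R : realType) k (x : F2pairs k) :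
  (pauli R x)^T = sgn R (qform x) *: pauli R x.
Proof.
apply/matrixP => i j; rewrite [LHS]mxE [RHS]mxE !pauliE addF2_eq.
case: eqP => [->|_]; last by rewrite !mulr0.
by rewrite dotDr sgnD /qform (dotC x.1); ring.
Qed.

Lemma mxtrace_pauli (R : realType) k (x : F2pairs k) :
  \tr (pauli R x) = (2 ^ k)%:R * (x == 0)%:R.
Proof.
rewrite /mxtrace; under eq_bigr => i _.
  rewrite pauliE -[X in X == _]addr0 (inj_eq (addrI _)) eq_sym dotC; over.
rewrite -mulr_suml (sum_label (fun v => sgn R (dot v x.2))) sum_sgn_dot -mulrA.
by rewrite -natrM mulnb; case: x => a b /=; rewrite xpair_eqE andbC.
Qed.

(** Summing over the Y part forces a = c by orthogonality of characters; then the only shift taking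
    a to b must also take c to d. *)
Lemma sum_pauli_tensor (R : realType) k (a b c d : 'I_(2 ^ k)) :
  \sum_x pauli R x a b * pauli R x c d =
  (2 ^ k)%:R * ((a == c)%:R * (b == d)%:R).
Proof.
transitivity (\sum_(al : 'rV['F_2]_k) \sum_(be : 'rV['F_2]_k)
    (sgn R (dot be (label a + label c)) *
     ((label b == label a + al)%:R * (label d == label c + al)%:R))).
  rewrite pair_bigA; apply: eq_bigr => -[al be] _; rewrite !pauliE /=.
  by rewrite dotDr sgnD; ring.
under eq_bigr => al _ do rewrite -mulr_suml sum_sgn_dot.
have -> : (label a + label c == 0) = (a == c).
  by rewrite -(inj_eq (@label_inj k)) [LHS]eq_sym addF2_eq add0r.
rewrite -mulr_sumr -mulrA; congr (_ * _).
have [->|_] := eqVneq a c; last by rewrite !mul0r.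
rewrite !mul1r (bigD1 (label b + label c)) //= [X in _ + X]big1 ?addr0.
  rewrite addrCA addF2 addr0 eqxx mul1r.
  by rewrite (inj_eq (@label_inj k)) eq_sym.
move=> al al0; rewrite (_ : (label b == _) = false) ?mul0r //.
by apply: contraNF al0 => /eqP ->; rewrite addrAC addF2 add0r.
Qed.

(** The indicator of q = 0 is (1 + (-1)^q) / 2, and by [tr_pauli] the sign (-1)^q transposes the
    first factor, that is, exchanges a and b. *)
Lemma sum_isotropic_pauli_tensor (R : realType) k (a b c d : 'I_(2 ^ k)) :
  \sum_(x : F2pairs k | qform x == 0) pauli R x a b * pauli R x c d =
  (2 ^ k)%:R / 2%:R *
    ((a == c)%:R * (b == d)%:R + (b == c)%:R * (a == d)%:R).
Proof.
rewrite mulrDr ![_ / 2 * _]mulrAC -!sum_pauli_tensor -mulrDl -big_split /=.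
rewrite mulr_suml big_mkcond; apply: eq_bigr => x _ /=.
have := congr1 (fun M : 'M[R]_(2 ^ k) => M a b) (tr_pauli R x).
rewrite [LHS]mxE [RHS]mxE => ->; case: (F2_cases (qform x)) => -> /=.
  by rewrite sgn0; field.
by rewrite /sgn /= expr1; ring.
Qed.

(** * Coordinates and characters on an isotropic subspace *)

Definition isotropic k (S : {vspace F2pairs k}) : Prop :=
  forall x, x \in S -> qform x = 0.

(** The length r is independent of [\dim S], so that all members of a spread share one index type;
    basis entries beyond the dimension are 0. *)
Definition coords k (S : {vspace F2pairs k}) r (c : 'rV['F_2]_r) : F2pairs k :=
  \sum_(i < r) c 0 i *: (vbasis S)`_i.

Lemma coordsD k (S : {vspace F2pairs k}) r (c d : 'rV['F_2]_r) :
  coords S (c + d) = coords S c + coords S d.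
Proof.
by rewrite -big_split; apply: eq_bigr => i _; rewrite mxE scalerDl.
Qed.

Lemma coords_mem k (S : {vspace F2pairs k}) r (c : 'rV['F_2]_r) :
  coords S c \in S.
Proof.
apply: rpred_sum => i _; apply: rpredZ.
have [iS|iS] := ltnP i (size (vbasis S)).
  exact/vbasis_mem/mem_nth.
by rewrite nth_default ?mem0v.
Qed.

Lemma coords_inj k (S : {vspace F2pairs k}) r :
  \dim S = r -> injective (@coords k S r).
Proof.
move=> <- c d cd; apply/rowP => i.
have fS : free (vbasis S) := basis_free (vbasisP S).
have := congr1 (coord (vbasis S) i) cd.
by rewrite !coord_sum_free.
Qed.

Lemma coords_surj k (S : {vspace F2pairs k}) r x :
  \dim S = r -> x \in S -> exists c : 'rV_r, x = coords S c.
Proof.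
move=> <- xS; exists (\row_i coord (vbasis S) i x).
by rewrite {1}(coord_vbasis xS); apply: eq_bigr => i _; rewrite mxE.
Qed.

Lemma sum_coords (R : realType) k (S : {vspace F2pairs k}) r
    (f : F2pairs k -> R) :
  \dim S = r -> \sum_(c : 'rV_r) f (coords S c) = \sum_(x | x \in S) f x.
Proof.
move=> dS; pose h := @coords k S r.
have hinj : injective h := coords_inj dS.
rewrite -(big_imset (h := h) f (A := predT)) /=; last by move=> c d _ _; apply: hinj.
apply: eq_bigl => x; apply/imsetP/idP => [[c _ ->]|]; first exact: coords_mem.
by move=> /(coords_surj dS)[c ->]; exists c.
Qed.

Definition beta k (x y : F2pairs k) : 'F_2 := dot x.1 y.2.

Lemma betaDl k (x y z : F2pairs k) : beta (x + y) z = beta x z + beta y z.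
Proof. exact: dotDl. Qed.

Lemma betaDr k (x y z : F2pairs k) : beta z (x + y) = beta z x + beta z y.
Proof. exact: dotDr. Qed.

Lemma betaZl k a (x y : F2pairs k) : beta (a *: x) y = a * beta x y.
Proof. exact: dotZl. Qed.

Lemma betaZr k a (x y : F2pairs k) : beta x (a *: y) = a * beta x y.
Proof. exact: dotZr. Qed.

(** Since q(x) = [beta x x], expanding q(x + y) = 0 on S leaves [beta x y + beta y x = 0]. *)
Lemma beta_sym k (S : {vspace F2pairs k}) x y :
  isotropic S -> x \in S -> y \in S -> beta x y = beta y x.
Proof.
move=> iS xS yS; have := iS _ (rpredD xS yS).
rewrite /qform -/(beta _ _) betaDl !betaDr.
rewrite [beta x x](iS x) // [beta y y](iS y) // addr0 add0r.
by case: (F2_cases (beta x y)) => ->; case: (F2_cases (beta y x)) => ->.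
Qed.

Lemma beta_coords k (S : {vspace F2pairs k}) r (c d : 'rV['F_2]_r) :
  beta (coords S c) (coords S d) =
  \sum_i \sum_j c 0 i * d 0 j * beta (vbasis S)`_i (vbasis S)`_j.
Proof.
have b0l (x : F2pairs k) : beta 0 x = 0 by exact: dot0l.
have b0r (x : F2pairs k) : beta x 0 = 0 by rewrite /beta dotC dot0l.
rewrite (big_morph (fun x => beta x _) (fun x y => betaDl x y _) (b0l _)).
apply: eq_bigr => i _; rewrite betaZl.
rewrite (big_morph (beta _) (fun x y => betaDr x y _) (b0r _)) mulr_sumr.
by apply: eq_bigr => j _; rewrite betaZr mulrA.
Qed.

(* A quadratic form on S with polarization [beta]: it absorbs the cocycle of the
   Pauli operators, so [eps] below runs through the characters of the preimage of
   S that send -I to -1. *)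
Definition quad k (S : {vspace F2pairs k}) r (c : 'rV['F_2]_r) : 'F_2 :=
  \sum_(i < r) \sum_(j < r | (i < j)%N)
    c 0 i * c 0 j * beta (vbasis S)`_i (vbasis S)`_j.

(** A symmetric form cannot be halved in characteristic 2, so [quad] takes the upper triangle of its
    Gram matrix. On S the diagonal of that matrix is q = 0, and symmetry folds the lower triangle
    onto the upper one. *)
Lemma quadD k (S : {vspace F2pairs k}) r (c d : 'rV['F_2]_r) :
  isotropic S ->
  quad S (c + d) = quad S c + quad S d + beta (coords S c) (coords S d).
Proof.
move=> iS; pose B (i j : 'I_r) := beta (vbasis S)`_i (vbasis S)`_j.
have bS (i : 'I_r) : (vbasis S)`_i \in S.
  have [i_lt|i_ge] := ltnP i (size (vbasis S)); first exact/vbasis_mem/mem_nth.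
  by rewrite nth_default ?mem0v.
have Bsym i j : B i j = B j i by apply: (beta_sym iS).
have B0 i : B i i = 0 by apply: (iS (vbasis S)`_i).
have -> : beta (coords S c) (coords S d) =
    \sum_(i < r) \sum_(j < r | (i < j)%N) (c 0 i * d 0 j + d 0 i * c 0 j) * B i j.
  rewrite beta_coords.
  transitivity (\sum_(i < r) (\sum_(j < r | (i < j)%N) c 0 i * d 0 j * B i j +
                 \sum_(j < r | (j < i)%N) c 0 i * d 0 j * B i j)).
    apply: eq_bigr => i _; rewrite (bigID (fun j : 'I_r => (i < j)%N)) /=.
    congr (_ + _); rewrite (bigID (fun j : 'I_r => j == i)) /=.
    rewrite big1 ?add0r; last first.
      by move=> j /andP[_ /eqP ->]; rewrite -/(B i i) B0 mulr0.
    by apply: eq_bigl => j; rewrite -leqNgt ltn_neqAle andbC.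
  rewrite big_split /= [X in _ + X](exchange_big_dep xpredT) //= -big_split.
  apply: eq_bigr => i _ /=; rewrite -big_split; apply: eq_bigr => j _ /=.
  by rewrite (Bsym j i); ring.
rewrite /quad -!big_split /=; apply: eq_bigr => i _.
by rewrite -!big_split /=; apply: eq_bigr => j _; rewrite !mxE -/(B i j); ring.
Qed.

Definition eps (R : realType) k (S : {vspace F2pairs k}) r
    (th c : 'rV['F_2]_r) : R := sgn R (quad S c + dot th c).

Lemma eps_sqr (R : realType) k (S : {vspace F2pairs k}) r (th c : 'rV_r) :
  eps R S th c * eps R S th c = 1.
Proof. exact: sgn_sqr. Qed.

(** The extra sign cancels that of [pauliM]: the operators [eps R S th c *: pauli R (coords S c)]
    multiply as the vectors c add. *)
Lemma epsD (R : realType) k (S : {vspace F2pairs k}) r (th c d : 'rV_r) :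
  isotropic S ->
  eps R S th (c + d) =
  eps R S th c * eps R S th d * sgn R (beta (coords S c) (coords S d)).
Proof. by move=> iS; rewrite /eps quadD // dotDr !sgnD; ring. Qed.

Lemma sum_eps (R : realType) k (S : {vspace F2pairs k}) r (c d : 'rV_r) :
  \sum_th eps R S th c * eps R S th d = (2 ^ r)%:R * (c == d)%:R.
Proof.
transitivity (\sum_(th : 'rV['F_2]_r) sgn R (dot th (c + d)) *
    sgn R (quad S c + quad S d)).
  by apply: eq_bigr => th _; rewrite /eps dotDr !sgnD; ring.
rewrite -mulr_suml sum_sgn_dot eq_sym addF2_eq add0r.
have [->|_] := eqVneq c d; last by rewrite !mulr0 mul0r.
by rewrite mulr1 sgnD sgn_sqr mulr1.
Qed.

(** * Eigenprojections and eigenspaces *)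

Definition eigenproj (R : realType) k (S : {vspace F2pairs k}) r
    (th : 'rV['F_2]_r) : 'M[R]_(2 ^ k) :=
  (2 ^ r)%:R^-1 *: \sum_c eps R S th c *: pauli R (coords S c).

Lemma pow2_neq0 (R : realType) r : (2 ^ r)%:R != 0 :> R.
Proof. by rewrite pnatr_eq0 expn_eq0. Qed.

Lemma eigenproj_pauli (R : realType) k (S : {vspace F2pairs k}) r
    (th c : 'rV_r) :
  isotropic S ->
  eigenproj R S th *m pauli R (coords S c) = eps R S th c *: eigenproj R S th.
Proof.
move=> iS; rewrite /eigenproj -scalemxAl scalerA mulrC -scalerA; congr (_ *: _).
rewrite mulmx_suml [in RHS](reindex_inj (addIr c)) scaler_sumr /=.
apply: eq_bigr => d _; rewrite -scalemxAl pauliM !scalerA -coordsD.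
rewrite epsD // -/(beta _ _) -[X in X *: _]mul1r -(eps_sqr R S th c).
congr (_ *: _); ring.
Qed.

Lemma eigenproj_idem (R : realType) k (S : {vspace F2pairs k}) r (th : 'rV_r) :
  isotropic S -> eigenproj R S th *m eigenproj R S th = eigenproj R S th.
Proof.
move=> iS; rewrite {2}/eigenproj -scalemxAr mulmx_sumr.
under eq_bigr => c _ do
  rewrite -scalemxAr eigenproj_pauli // scalerA eps_sqr scale1r.
by rewrite sumr_const card_F2 -[eigenproj _ _ _ *+ _]scaler_nat scalerA mulVf
  ?scale1r ?pow2_neq0.
Qed.

Lemma tr_eigenproj (R : realType) k (S : {vspace F2pairs k}) r (th : 'rV_r) :
  isotropic S -> (eigenproj R S th)^T = eigenproj R S th.
Proof.
move=> iS; rewrite /eigenproj linearZ /= linear_sum; congr (_ *: _).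
apply: eq_bigr => c _; rewrite linearZ /= tr_pauli iS ?coords_mem //.
by rewrite sgn0 scale1r.
Qed.

Lemma coords0 k (S : {vspace F2pairs k}) r : coords S (0 : 'rV['F_2]_r) = 0.
Proof. by apply: big1 => i _; rewrite mxE scale0r. Qed.

Lemma eps0 (R : realType) k (S : {vspace F2pairs k}) r (th : 'rV_r) :
  eps R S th 0 = 1.
Proof.
rewrite /eps dotC dot0l addr0 /quad big1 ?sgn0 // => i _.
by apply: big1 => j _; rewrite !mxE !mul0r.
Qed.

(** For x outside S, no operator of S times that of x is scalar, so every term has trace 0. This
    separates the eigenspaces of different members of the spread. *)
Lemma mxtrace_eigenproj_pauli (R : realType) k (S : {vspace F2pairs k}) r
    (th : 'rV_r) x :
  x \notin S -> \tr (eigenproj R S th *m pauli R x) = 0.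
Proof.
move=> xS; rewrite /eigenproj -scalemxAl linearZ /= mulmx_suml linear_sum /=.
rewrite big1 ?mulr0 // => c _; rewrite -scalemxAl pauliM !linearZ /=.
rewrite mxtrace_pauli (_ : (_ + _ == 0) = false) ?mulr0 //.
rewrite eq_sym addF2_eq add0r; apply: contraNF xS => /eqP <-.
exact: coords_mem.
Qed.

Lemma mxtrace_eigenproj (R : realType) k (S : {vspace F2pairs k}) r
    (th : 'rV_r) :
  \dim S = r -> \tr (eigenproj R S th) = (2 ^ k)%:R / (2 ^ r)%:R.
Proof.
move=> dS; rewrite /eigenproj linearZ /= linear_sum /= mulrC; congr (_ * _).
rewrite (bigD1 0) //= [X in _ + X]big1 ?addr0.
  by rewrite linearZ /= eps0 mul1r coords0 mxtrace_pauli eqxx mulr1.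
move=> c c0; rewrite linearZ /= mxtrace_pauli (_ : (_ == 0) = false) ?mulr0 //.
by apply: contraNF c0 => /eqP; rewrite -(coords0 S r) => /(coords_inj dS) ->.
Qed.

Lemma sum_eigenproj (R : realType) k (S : {vspace F2pairs k}) r :
  \sum_(th : 'rV_r) eigenproj R S th = 1%:M.
Proof.
rewrite /eigenproj -scaler_sumr exchange_big /=.
rewrite (bigD1 0) //= [X in _ + X]big1 ?addr0.
  rewrite -scaler_suml; under eq_bigr do rewrite eps0.
  rewrite sumr_const card_F2 scalerA mulVf ?pow2_neq0 // scale1r.
  by rewrite coords0 pauli0.
move=> c /negPf c0; rewrite -scaler_suml.
(* Inserting [eps R S th 0 = 1] turns the sum into an instance of character orthogonality. *)
under eq_bigr => th _ do rewrite -[eps _ _ _ _]mulr1 -(eps0 R S th).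
by rewrite sum_eps c0 mulr0 scale0r.
Qed.

Lemma sum_eigenproj_tensor (R : realType) k (S : {vspace F2pairs k}) r a b c d :
  \dim S = r ->
  \sum_(th : 'rV_r) eigenproj R S th a b * eigenproj R S th c d =
  (2 ^ r)%:R^-1 * \sum_(x | x \in S) pauli R x a b * pauli R x c d.
Proof.
move=> dS; rewrite -(sum_coords (fun x => pauli R x a b * pauli R x c d) dS).
have E th i j : eigenproj R S th i j =
    (2 ^ r)%:R^-1 * \sum_(e : 'rV_r) eps R S th e * pauli R (coords S e) i j.
  rewrite mxE summxE; congr (_ * _); apply: eq_bigr => e _; by rewrite mxE.
under eq_bigr => th _ do rewrite !E mulrACA mulr_suml.
rewrite -mulr_sumr exchange_big -mulrA /=; congr (_ * _).
rewrite mulr_sumr; apply: eq_bigr => e _.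
under eq_bigr => th _ do rewrite mulr_sumr.
rewrite exchange_big /= (bigD1 e) //= [X in _ + X]big1 ?addr0.
  under eq_bigr => th _ do rewrite mulrACA.
  by rewrite -mulr_suml sum_eps eqxx mulr1 mulrA mulVf ?mul1r //.
move=> f /negPf fe; under eq_bigr => th _ do rewrite mulrACA.
by rewrite -mulr_suml sum_eps eq_sym fe mulr0 mul0r.
Qed.

Lemma eigenprojP (R : realType) k (S : {vspace F2pairs k}) r (th : 'rV_r)
    (v : 'rV[R]_(2 ^ k)) :
  isotropic S ->
  v *m eigenproj R S th = v <->
  forall c, v *m pauli R (coords S c) = eps R S th c *: v.
Proof.
move=> iS; split=> [vP c|vG].
  by rewrite -{1}vP -mulmxA eigenproj_pauli // -scalemxAr vP.
rewrite /eigenproj -scalemxAr mulmx_sumr.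
under eq_bigr => c _ do rewrite -scalemxAr vG scalerA eps_sqr scale1r.
by rewrite sumr_const card_F2 -[v *+ _]scaler_nat scalerA mulVf
  ?scale1r ?pow2_neq0.
Qed.

Definition eigenspace_of (R : realType) k (S : {vspace F2pairs k}) r
    (th : 'rV['F_2]_r) : {vspace 'rV[R]_(2 ^ k)} :=
  limg (linfun (mulmxr (eigenproj R S th))).

Lemma mem_eigenspace_of (R : realType) k (S : {vspace F2pairs k}) r
    (th : 'rV_r) v :
  isotropic S -> v \in eigenspace_of R S th <-> v *m eigenproj R S th = v.
Proof.
move=> iS; split=> [/memv_imgP[w _ ->]|e].
  by rewrite lfunE /= -mulmxA eigenproj_idem.
by apply/memv_imgP; exists v; rewrite ?memvf // lfunE.
Qed.

Lemma dim_eigenspace_of (R : realType) k (S : {vspace F2pairs k}) r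
    (th : 'rV_r) :
  isotropic S -> \dim S = r -> (r <= k)%N ->
  \dim (eigenspace_of R S th) = (2 ^ (k - r))%N.
Proof.
move=> iS dS rk; have UP (v : 'rV[R]_(2 ^ k)) := mem_eigenspace_of th v iS.
have [trP _] := projection_diagonalization (tr_eigenproj R th iS)
  (eigenproj_idem R th iS) UP.
apply/eqP; rewrite -(eqr_nat R) -trP mxtrace_eigenproj //.
by rewrite -(subnK rk) expnD natrM mulfK ?pow2_neq0 // addnK.
Qed.

Lemma mem_preimage (R : realType) k (S : {vspace F2pairs k}) r (c : 'rV_r) :
  preimage_in_E R S (pauli R (coords S c)).
Proof.
split; first by apply: extraspecialM; [apply: extraspecialY|apply: extraspecialX].
by exists (coords S c); [exact: coords_mem | exists false; rewrite expr0 scale1r].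
Qed.

Lemma eigenspace_of_D (R : realType) k (S : {vspace F2pairs k}) r (th : 'rV_r) :
  isotropic S -> \dim S = r -> (r <= k)%N -> D_ R S (eigenspace_of R S th).
Proof.
move=> iS dS rk; split.
  by rewrite -dimv_eq0 (dim_eigenspace_of R th iS dS rk) expn_eq0.
pose P := eigenproj R S th.
(* The eigenvalue must depend on the matrix g alone. As P g is a scalar multiple of P, the
   normalized trace recovers that scalar, sign included. *)
exists (fun g => \tr (P *m g) / \tr P) => v.
have trP0 : \tr P != 0.
  by rewrite mxtrace_eigenproj // mulf_neq0 ?invr_eq0 ?pow2_neq0.
split=> [/(mem_eigenspace_of _ _ iS) vP g [_ [x xS [e ->]]]|vg].
  have [c ->] := coords_surj dS xS; rewrite -/(pauli R _).
  rewrite -!scalemxAr linearZ /= eigenproj_pauli // linearZ /=.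
  by rewrite mulrA mulfK // ((eigenprojP _ _ iS).1 vP) scalerA.
apply/(mem_eigenspace_of _ _ iS)/(eigenprojP _ _ iS) => c.
rewrite (vg _ (mem_preimage _ _ _)) eigenproj_pauli // linearZ /=.
by rewrite mulfK.
Qed.

(** The eigenprojections sum to 1, so one of them does not kill a chosen nonzero v in U. As v is a
    common eigenvector, that projection maps it to a nonzero multiple of itself, which identifies
    chi with [eps] at this th. *)
Lemma D_eigenspace_of (R : realType) k (S : {vspace F2pairs k}) r U :
  isotropic S -> \dim S = r -> D_ R S U ->
  exists th : 'rV_r, U = eigenspace_of R S th.
Proof.
move=> iS dS [U0 [chi Uchi]].
pose v := vpick U; have v0 : v != 0 by rewrite vpick0.
have vU : v \in U by exact: memv_pick.
have vG (c : 'rV_r) := (Uchi v).1 vU _ (mem_preimage R S c).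
have [th vth] : exists th : 'rV_r, v *m eigenproj R S th != 0.
  apply: contrapT => /forallNP H; move/eqP: v0; apply.
  rewrite -[v]mulmx1 -(sum_eigenproj R S r) mulmx_sumr big1 // => th _.
  by apply/eqP; apply: contrapT => /negP; exact: H.
have [l lE] : exists l, v *m eigenproj R S th = l *: v.
  exists ((2 ^ r)%:R^-1 * \sum_c eps R S th c * chi (pauli R (coords S c))).
  rewrite /eigenproj -scalemxAr mulmx_sumr -scalerA scaler_suml; congr (_ *: _).
  by apply: eq_bigr => c _; rewrite -scalemxAr vG scalerA.
have l0 : l != 0 by apply: contraNneq vth => l0; rewrite lE l0 scale0r.
have chiE c : chi (pauli R (coords S c)) = eps R S th c.
  have : l *: v *m pauli R (coords S c) = l *: (eps R S th c *: v).
    by rewrite -lE -mulmxA eigenproj_pauli // -scalemxAr lE !scalerA mulrC.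
  rewrite -scalemxAl vG => /(scalerI l0) /eqP.
  rewrite -subr_eq0 -scalerBl scaler_eq0 (negPf v0) orbF subr_eq0 => /eqP.
  by [].
exists th; apply/vspaceP => w; apply/idP/idP.
  move=> /Uchi wg; apply/(mem_eigenspace_of _ _ iS)/(eigenprojP _ _ iS) => c.
  by rewrite wg ?chiE //; exact: mem_preimage.
move=> /(mem_eigenspace_of _ _ iS)/(eigenprojP _ _ iS) wc; apply/Uchi.
move=> g Eg; case: (Eg) => _ [x xS [e gE]].
have [c xc] := coords_surj dS xS.
have -> : chi g = (-1) ^+ e * eps R S th c.
  have := (Uchi v).1 vU _ Eg; rewrite {1}gE xc -/(pauli R _) -scalemxAr vG chiE.
  rewrite scalerA => /esym/eqP.
  by rewrite -subr_eq0 -scalerBl scaler_eq0 (negPf v0) orbF subr_eq0 => /eqP.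
by rewrite gE xc -/(pauli R _) -scalemxAr wc scalerA.
Qed.

(** A common nonzero vector has one eigenvalue under each operator; those at the unit vectors
    determine the coordinates of th. *)
Lemma eigenspace_of_inj (R : realType) k (S : {vspace F2pairs k}) r :
  isotropic S -> \dim S = r -> (r <= k)%N ->
  injective (@eigenspace_of R k S r).
Proof.
move=> iS dS rk th th' e.
have [U0 _] := eigenspace_of_D R th iS dS rk.
pose v := vpick (eigenspace_of R S th); have v0 : v != 0 by rewrite vpick0.
have vU : v \in eigenspace_of R S th by exact: memv_pick.
have vU' : v \in eigenspace_of R S th' by rewrite -e.
have vc := (eigenprojP th v iS).1 ((mem_eigenspace_of th v iS).1 vU).
have vc' := (eigenprojP th' v iS).1 ((mem_eigenspace_of th' v iS).1 vU').
apply/rowP => i; rewrite -!dot_delta ![dot (delta_mx _ _) _]dotC.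
apply: (addrI (quad S (delta_mx 0 i : 'rV_r))); apply: (@sgn_inj R).
have := vc' (delta_mx 0 i); rewrite vc => /eqP.
by rewrite -subr_eq0 -scalerBl scaler_eq0 (negPf v0) orbF subr_eq0 => /eqP.
Qed.

(** Take x nonzero in S, hence outside T. If the eigenspaces agreed, the operator of x would act on
    the image of the T-projection by a sign, and the trace of their product would be nonzero,
    against [mxtrace_eigenproj_pauli]. *)
Lemma eigenspace_of_disjoint (R : realType) k (S T : {vspace F2pairs k}) r
    (th th' : 'rV_r) :
  isotropic S -> isotropic T -> \dim S = r -> \dim T = r -> (0 < r)%N ->
  (S :&: T = 0)%VS -> eigenspace_of R S th <> eigenspace_of R T th'.
Proof.
move=> iS iT dS dT r0 ST e.
have S0 : S != 0%VS by rewrite -dimv_eq0 dS -lt0n.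
pose x := vpick S; have x0 : x != 0 by rewrite vpick0.
have xS : x \in S by exact: memv_pick.
have xT : x \notin T.
  apply: contra x0 => xT.
  have : x \in (S :&: T)%VS by rewrite memv_cap xS xT.
  by rewrite ST memv0.
have [c xc] := coords_surj dS xS.
have : eigenproj R T th' *m pauli R x = eps R S th c *: eigenproj R T th'.
  apply/row_matrixP => i; rewrite row_mul xc [RHS]linearZ /=.
  have rS : row i (eigenproj R T th') *m eigenproj R S th =
      row i (eigenproj R T th').
    apply/(mem_eigenspace_of _ _ iS); rewrite e.
    by apply/(mem_eigenspace_of _ _ iT); rewrite -row_mul eigenproj_idem.
  exact: (eigenprojP th _ iS).1 rS c.
move=> /(congr1 mxtrace); rewrite (mxtrace_eigenproj_pauli R th' xT).
rewrite mxtraceZ (mxtrace_eigenproj R th' dT) => /esym/eqP; rewrite !mulf_eq0 invr_eq0.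
rewrite !(negPf (pow2_neq0 _ _)) !orbF => /eqP e0.
have := eps_sqr R S th c; rewrite e0 mul0r => /eqP.
by rewrite eq_sym oner_eq0.
Qed.

(** * Sums over a maximal spread *)

Lemma sum_delta (R : realType) n (f : 'I_n -> R) a :
  \sum_b f b * (a == b)%:R = f a.
Proof.
rewrite (bigD1 a) //= eqxx mulr1 big1 ?addr0 // => b.
by rewrite eq_sym => /negPf ->; rewrite mulr0.
Qed.

(** The delta products are the three pairings of the four slots. In the application al carries the
    zero vector and ga the sum over isotropic vectors. *)
Lemma traceless_pairings (R : realType) n (u : tensor R n 4) (al ga : R) :
  traceless u ->
  \sum_a \sum_b \sum_c \sum_d u (idx4 a b c d) *
    (al * ((a == b)%:R * (c == d)%:R) +
     ga * ((a == c)%:R * (b == d)%:R + (b == c)%:R * (a == d)%:R)) = 0.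
Proof.
move=> tr.
transitivity (\sum_a (al * (\sum_b (\sum_c \sum_d u (idx4 a b c d) *
      (c == d)%:R) * (a == b)%:R) +
    ga * \sum_b ((\sum_c (\sum_d u (idx4 a b c d) * (b == d)%:R) * (a == c)%:R) +
       \sum_c (\sum_d u (idx4 a b c d) * (a == d)%:R) * (b == c)%:R))).
  apply: eq_bigr => a _; rewrite 2!mulr_sumr -big_split; apply: eq_bigr => b _ /=.
  rewrite -big_split mulr_suml !mulr_sumr -big_split; apply: eq_bigr => c _ /=.
  rewrite !mulr_suml -big_split !mulr_sumr -big_split; apply: eq_bigr => d _ /=.
  ring.
apply: big1 => a _.
under eq_bigr => b _ do under eq_bigr => c _ do rewrite sum_delta.
rewrite sum_delta traceless_idx4_23 // mulr0 add0r.
under eq_bigr => b _ do (under eq_bigr => c _ do rewrite sum_delta;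
  under [in X in _ + X]eq_bigr => c _ do rewrite sum_delta;
  rewrite !sum_delta).
by rewrite big_split /= traceless_idx4_13 // traceless_idx4_12 // addr0 mulr0.
Qed.

(** Encodes a subspace in a finite type; without 0, the members of a spread become pairwise disjoint
    sets. *)
Definition nonzero_part k (S : {vspace F2pairs k}) : {set F2pairs k} :=
  [set x | (x \in S) && (x != 0)]%SET.

Definition span_of k (A : {set F2pairs k}) : {vspace F2pairs k} :=
  <<enum A>>%VS.

Lemma nonzero_partK k : cancel (@nonzero_part k) (@span_of k).
Proof.
move=> S; apply/eqP; rewrite eqEsubv; apply/andP; split.
  by apply/span_subvP => x; rewrite mem_enum inE => /andP[].
apply/subvP => x xS; have [->|x0] := eqVneq x 0; first exact: mem0v.
by apply: memv_span; rewrite mem_enum inE xS x0.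
Qed.

Definition spread_parts k (Sigma : set {vspace F2pairs k}) :
    {set {set F2pairs k}} :=
  [set A | `[< exists2 S, Sigma S & A = nonzero_part S >]]%SET.

Lemma spread_partsP k (Sigma : set {vspace F2pairs k}) A :
  A \in spread_parts Sigma -> Sigma (span_of A) /\ nonzero_part (span_of A) = A.
Proof. by rewrite inE => /asboolP[S SS ->]; rewrite nonzero_partK. Qed.

Lemma mem_spread_parts k (Sigma : set {vspace F2pairs k}) S :
  Sigma S -> nonzero_part S \in spread_parts Sigma.
Proof. by move=> SS; rewrite inE; apply/asboolP; exists S. Qed.

(** Nonzero isotropic vectors occur in exactly one member, while 0 occurs in all of them; the -1
    compensates the 0 inside the isotropic sum. *)
Lemma sum_spread (R : realType) k w (Sigma : set {vspace F2pairs k})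
    (F : F2pairs k -> R) :
  maximal_spread w Sigma ->
  \sum_(A in spread_parts Sigma) \sum_(x | x \in span_of A) F x =
  (#|spread_parts Sigma|%:R - 1) * F 0 + \sum_(x | qform x == 0) F x.
Proof.
move=> [[_ disj] cov].
transitivity (\sum_(A in spread_parts Sigma) (F 0 + \sum_(x in A) F x)).
  apply: eq_bigr => A /spread_partsP[_ EA].
  rewrite (bigD1 (0 : F2pairs k)) ?mem0v //=; congr (_ + _).
  by apply: eq_bigl => x; rewrite -[in RHS]EA inE.
rewrite big_split /= sumr_const -[F 0 *+ _]mulr_natl mulrBl mul1r -addrA.
congr (_ + _).
rewrite -finset.big_trivIset /=; last first.
  apply/finset.trivIsetP => A B /spread_partsP[SA EA] /spread_partsP[SB EB] AB.
  rewrite -finset.setI_eq0; apply/eqP/finset.setP => x; rewrite -EA -EB !inE; apply/negP.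
  move=> /andP[/andP[xA x0] /andP[xB _]]; move/negP: x0; apply.
  have : x \in (span_of A :&: span_of B)%VS by rewrite memv_cap xA xB.
  rewrite (disj _ _ SA SB) ?memv0 // => e.
  by move/eqP: AB; apply; rewrite -EA -EB e.
rewrite [in RHS](bigD1 (0 : F2pairs k)) /=; last by rewrite /qform dot0l.
rewrite addKr; apply: eq_bigl => x.
have covx := congr1 (fun X : set (F2pairs k) => X x) cov.
apply/finset.bigcupP/andP => [[A /spread_partsP[SA EA]]|[/eqP qx x0]].
  rewrite -EA inE => /andP[xA ->]; split=> //; apply/eqP.
  by rewrite -[_ = _]/([set x | qform x = 0] x) -covx; exists (span_of A).
have : [set x : F2pairs k | qform x = 0] x by [].
rewrite -covx => -[S SS /= xS].
exists (nonzero_part S); first exact: mem_spread_parts.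
by rewrite inE xS.
Qed.

Lemma bigcup_D_image (R : realType) k w (Sigma : set {vspace F2pairs k}) :
  Sigma `<=` isotropic_subspaces k w -> (w <= k)%N ->
  \bigcup_(S in Sigma) D_ R S =
  (fun p : {set F2pairs k} * 'rV['F_2]_w => eigenspace_of R (span_of p.1) p.2) @`
    [set` [pred p : {set F2pairs k} * 'rV['F_2]_w | p.1 \in spread_parts Sigma]].
Proof.
move=> SI wk; apply/seteqP; split=> U.
  move=> [S SS US]; have [dS iS] := SI _ SS.
  have [th ->] := D_eigenspace_of iS dS US.
  exists (nonzero_part S, th); last by rewrite /= nonzero_partK.
  exact: mem_spread_parts.
move=> [[A th] /spread_partsP[/= SA _] <-]; exists (span_of A) => //.
by have [dS iS] := SI _ SA; apply: eigenspace_of_D.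
Qed.

(** In the union a subspace arising from two pairs (A, th) would count only once; disjointness of
    the spread members and injectivity in th exclude such repetitions. *)
Lemma sum_design (R : realType) k w (Sigma : set {vspace F2pairs k})
    (f : {vspace 'rV[R]_(2 ^ k)} -> R) :
  spread w Sigma -> (0 < w <= k)%N ->
  \sum_(U \in \bigcup_(S in Sigma) D_ R S) f U =
  \sum_(A in spread_parts Sigma) \sum_(th : 'rV['F_2]_w)
    f (eigenspace_of R (span_of A) th).
Proof.
move=> [SI disj] /andP[w0 wk]; rewrite (bigcup_D_image R SI wk) fsbig_image.
  rewrite -(@bigfs _ _ _ _ (index_enum ({set F2pairs k} * 'rV['F_2]_w)%type))
    ?index_enum_uniq //; last by move=> i; rewrite mem_index_enum.
  by rewrite [RHS]pair_big_dep /=; apply: eq_bigl => p; rewrite andbT.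
move=> [A th] [B th'] /set_mem /spread_partsP[/= SA EA].
move=> /set_mem /spread_partsP[/= SB EB] e.
have [dA iA] := SI _ SA; have [dB iB] := SI _ SB.
have AB : span_of A = span_of B.
  apply: contrapT => AB.
  exact: (eigenspace_of_disjoint iA iB dA dB w0 (disj _ _ SA SB AB) e).
move: e => /=; rewrite AB => e; have -> := eigenspace_of_inj iB dB wk e.
by congr (_, _); rewrite -EA AB EB.
Qed.

Theorem theorem9 (R : realType) (k s : nat)
    (hk : (1 <= k)%N) (hs : (s < k)%N)
    (Sigma : set {vspace F2pairs k})
    (hSigma : maximal_spread (k - s) Sigma) :
  @is_4design R (2 ^ s) (2 ^ k) (\bigcup_(S in Sigma) D_ R S).
Proof.
have [hspr hcov] := hSigma; have [SI _] := hspr.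
have w0 : (0 < k - s)%N by rewrite subn_gt0.
have wk : (k - s <= k)%N by rewrite leq_subr.
have dimU A (th : 'rV['F_2]_(k - s)) : A \in spread_parts Sigma ->
    \dim (eigenspace_of R (span_of A) th) = (2 ^ s)%N.
  move=> /spread_partsP[/SI[dA iA] _].
  by rewrite (dim_eigenspace_of R th iA dA wk) subKn // ltnW.
have mn : (2 ^ s <= 2 ^ k)%N by rewrite leq_pexp2l // ltnW.
split.
- rewrite (bigcup_D_image R SI wk) => U [[A th] /= AS <-]; exact: dimU.
- rewrite (bigcup_D_image R SI wk); apply: finite_image; exact: finite_finset.
(* For each shape only two facts remain: uniqueness of the fixed vector, and vanishing of the summed
   pairing with the projections. *)
have reduce lam (Pi : 'M[R]_(2 ^ k) -> tensor R (2 ^ k) (sumn lam)) :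
    (forall g P, move_tensor g (Pi P) = Pi (g^T *m P *m g)) ->
    (forall u, weyl_module u -> stabilizer_fixed (2 ^ s) u ->
       tdot u (Pi (pid_mx (2 ^ s))) = 0 -> u = 0) ->
    (forall w, weyl_module w -> \sum_(A in spread_parts Sigma)
       \sum_(th : 'rV['F_2]_(k - s)) tdot w (Pi (eigenproj R (span_of A) th)) = 0) ->
    forall f, isotypic (2 ^ s) lam f ->
    \sum_(U \in \bigcup_(S in Sigma) D_ R S) f U = 0.
  move=> Pimove uniq sum0 f [phi [phiI [w Ww fE]]].
  rewrite (sum_design _ hspr) ?w0 //.
  have [c cE] := intertwiner_scalar mn Pimove uniq phiI.
  transitivity (c * \sum_(A in spread_parts Sigma) \sum_(th : 'rV['F_2]_(k - s))
      tdot w (Pi (eigenproj R (span_of A) th))); last by rewrite sum0 // mulr0.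
  rewrite mulr_sumr; apply: eq_bigr => A AS; rewrite mulr_sumr.
  apply: eq_bigr => th _; have [/SI[dA iA] _] := spread_partsP AS.
  rewrite fE; last exact: dimU.
  apply: cE => //; [exact: tr_eigenproj|exact: eigenproj_idem| |exact: dimU].
  by move=> v; apply: mem_eigenspace_of.
have sum4 (w : tensor R (2 ^ k) 4) : traceless w ->
    \sum_(A in spread_parts Sigma) \sum_(th : 'rV['F_2]_(k - s))
      tdot w (proj_tensor4 (eigenproj R (span_of A) th)) = 0.
  move=> tw; pose r2 : R := (2 ^ (k - s))%:R^-1.
  (* Each S contributes the factor 2^-(k-s). The first coefficient is the excess multiplicity of the
     zero vector, the second is 2^k / 2 from the isotropic sum. *)
  rewrite -[RHS](traceless_pairings (r2 * (#|spread_parts Sigma|%:R - 1))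
    (r2 * ((2 ^ k)%:R / 2%:R)) tw).
  under eq_bigr => A AS do under eq_bigr => th _ do rewrite tdot_proj_tensor4.
  rewrite pair_big_dep exchange_big /=; apply: eq_bigr => a _.
  rewrite exchange_big /=; apply: eq_bigr => b _.
  rewrite exchange_big /=; apply: eq_bigr => c _.
  rewrite exchange_big /=; apply: eq_bigr => d _.
  rewrite -mulr_sumr; congr (_ * _).
  rewrite -(pair_big_dep (fun A => A \in spread_parts Sigma)
    (fun _ _ => true) (fun A (th : 'rV['F_2]_(k - s)) =>
      eigenproj R (span_of A) th a b * eigenproj R (span_of A) th c d)) /=.
  under eq_bigr => A AS.
    have [/SI[dA iA] _] := spread_partsP AS.
    rewrite (sum_eigenproj_tensor R a b c d dA); over.
  rewrite -mulr_sumr (sum_spread _ hSigma) sum_isotropic_pauli_tensor pauli0.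
  by rewrite !mxE mulrDr !mulrA.
move=> mu pmu _ smu f; rewrite /grass_H.
(* Doubling these three partitions gives the shapes (2), (4) and (2, 2). *)
have [->|[->|->]] : mu = [:: 1%N] \/ mu = [:: 2%N] \/ mu = [:: 1%N; 1%N].
- case: mu pmu smu => [|[|[|[|a]]] [|[|[|b]] [|[|c] l]]] //=;
    rewrite /is_partition /= ?inE ?andbF //; by auto.
- apply: (@reduce [:: 2] (@proj_tensor2 R (2 ^ k))).
  + exact: move_proj_tensor2.
  + exact: weyl2_unique.
  (* In degree 2 each S contributes 0 by itself: its eigenprojections sum to the identity, so the
     pairing is the trace of w. *)
  move=> w [tw _]; apply: big1 => A _.
  under eq_bigr do rewrite tdot_proj_tensor2.
  rewrite exchange_big /= -[RHS](tw (@Ordinal 2 0 isT) (@Ordinal 2 1 isT)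
    (idx2 (unlabel 0) (unlabel 0)) isT).
  apply: eq_bigr => a _; rewrite exchange_big /=.
  under eq_bigr => b _ do rewrite -mulr_sumr -summxE sum_eigenproj mxE.
  rewrite sum_delta; congr (w _); apply/ffunP.
  by case=> -[|[|]] // l; rewrite !ffunE.
- apply: (@reduce [:: 4] (@proj_tensor4 R (2 ^ k))).
  + exact: move_proj_tensor4.
  + exact: weyl4_unique.
  by move=> w [tw _]; apply: sum4.
- apply: (@reduce [:: 2; 2] (@proj_tensor4 R (2 ^ k))).
  + exact: move_proj_tensor4.
  + exact: weyl22_unique.
  by move=> w [tw _]; apply: sum4.
Qed.
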